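(* Let $G$ be a finite connected bigraph, let $C$ be a set of colors, let $c\colon E(G)\to C'$ be a coloring of $G$, let $\mathcal{F}\subseteq\mathrm{Fold}((G,c))$ be a set of folds of $(G,c)$ that is $\mathrm{Aut}((G,c))$-invariant, let $\mathcal{M}=\{\ell\otimes c\mid \ell\colon V_1(G)\to C\text{ is monochromatic}\}$ and let $r\colon V_1(G)\to C$ be a rainbow left-coloring of $G$. Then the following are equivalent: (1) $G$ is $\mathcal{F}$-left-cut-percolating. (2) $\ell\otimes c\preceq_{\mathcal{F}}\mathcal{M}$ for every left-coloring $\ell\colon V_1(G)\to C$. (3) $r\otimes c\preceq_{\mathcal{F}}\mathcal{M}$. (4) $\ell\otimes c\ll_{\mathcal{F}}\mathcal{M}$ for every left-coloring $\ell\colon V_1(G)\to C$. (5) $r\otimes c\ll_{\mathcal{F}}\mathcal{M}$. (6) If $\ell\colon V_1(G)\to C$ is a left-coloring such that $\ell\otimes c$ is $(\mathrm{Aut}((G,c)),\mathcal{F})$-fold-stable, then $\ell$ is monochromatic. (7) If $\ell\colon V_1(G)\to C$ is a left-coloring such that $\ell\otimes c$ is $\mathrm{Fold}(G)$-strongly $(\mathrm{Aut}((G,c)),\mathcal{F})$-fold-stable, then $\ell$ is monochromatic. (8) If $\ell\colon V_1(G)\to C$ is a left-coloring such that $\ell\otimes c$ is $\preceq_{\mathcal{F}}$-maximal, then $\ell$ is monochromatic. (9) $G$ is $K$-left-vertex-transitive, where $K$ is the subgroup of $\mathrm{Aut}((G,c))$ generated by $\{f\mid(f,L)\in\mathcal{F}\}$,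 and for every left-coloring $\ell\colon V_1(G)\to C$, if $\ell\otimes c$ is $\mathrm{Fold}(G)$-left-symmetrically $(\mathrm{Aut}((G,c)),\mathcal{F})$-fold-stable, then $\ell$ is monochromatic.
   Context: A bigraph is a triple $G=(V_1(G),V_2(G),E(G))$ with $V_1(G),V_2(G)$ disjoint and $E(G)\subseteq V_1(G)\times V_2(G)$; $V(G)=V_1(G)\cup V_2(G)$. An automorphism of $G$ is a bijection $h$ of $V(G)$ with $h(V_i(G))=V_i(G)$ and $(u,v)\in E(G)\iff(h(u),h(v))\in E(G)$; $\mathrm{Aut}(G)$ is their group; maps act on pairs coordinatewise. Connectivity refers to the underlying undirected graph; $S\subseteq V(G)$ is a cut if the induced bigraph $G-S$ on $V(G)\setminus S$ is disconnected. A cut-involution is $f\in\mathrm{Aut}(G)$ with $f\circ f=\mathrm{id}$ and $\mathrm{Fix}(f)=\{v:f(v)=v\}$ a cut. A fold of $G$ is $(f,L)$ with $f$ a cut-involution, $L$ a union of connected components of $G-\mathrm{Fix}(f)$, and $(L,\mathrm{Fix}(f),f(L))$ a partition of $V(G)$; $\mathrm{Fold}(G)$ is the set of folds; the dual fold of $(f,L)$ is $(f,f(L))$. Folding maps: $f_L(v)=f(v)$ for $v\in\mathrm{Fix}(f)\cup f(L)$, $f_L(v)=v$ for $v\in L$; $f_L^*(v)=f(v)$ for $v\in L$, $f_L^*(v)=v$ otherwise. For a coloring $c\colon E(G)\to C'$, an isomorphism from $(G,c)$ to $(G,c')$ is $g\in\mathrm{Aut}(G)$ with $c'\circ g=c$,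 where $c\circ\varphi$ denotes $(u,v)\mapsto c(\varphi(u),\varphi(v))$; $\mathrm{Aut}((G,c))=\{g\in\mathrm{Aut}(G):c\circ g=c\}$; $\mathrm{Fold}((G,c))$ is the set of folds $(f,L)$ of $G$ with $f\in\mathrm{Aut}((G,c))$. A set $\mathcal{F}$ of folds is $K$-invariant if $(h\circ f\circ h^{-1},h(L))\in\mathcal{F}$ for all $h\in K$, $(f,L)\in\mathcal{F}$. $G$ is $K$-left-vertex-transitive if for all $u,v\in V_1(G)$ some $h\in K$ has $h(u)=v$. A left-coloring is a map $\ell\colon V_1(G)\to C$ (monochromatic if $|\mathrm{im}\,\ell|\le1$, rainbow if injective); $\ell\otimes c\colon E(G)\to C\times C'$ is $(u,v)\mapsto(\ell(u),c(u,v))$; $\sigma\circ\ell$ is composition with a map $\sigma$ of $C$. Reachability: for colorings $d,d'$, $d\preceq_{\mathcal{F}}d'$ if there are $t\ge0$ and folds $(f_1,L_1),\dots,(f_t,L_t)$, each of which or whose dual lies in $\mathcal{F}$, with $d'=d\circ(f_1)_{L_1}\circ\cdots\circ(f_t)_{L_t}$; $d\preceq_{\mathcal{F}}\mathcal{C}$ means $d\preceq_{\mathcal{F}}d'$ for some $d'\in\mathcal{C}$; $d$ is $\preceq_{\mathcal{F}}$-maximal if $d\preceq_{\mathcal{F}}d'$ implies $d'\preceq_{\mathcal{F}}d$. Percolation: a binary tree is a prefix-closed set $T$ of finite strings over $\{1,2\}$; $|\eta|$ is length; $L(T)$ the prefix-maximal elements; $T\!\uparrow=\{\emptyset\}\cup\{\eta\ne\emptyset:\eta\text{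 minus its last symbol}\in T\}$. For a folding tree $\phi\colon T\to\mathrm{Fold}(G)$ and coloring $d$, $\phi[d]\colon T\!\uparrow\to$ colorings is given by $\phi[d](\emptyset)=d$ and for $\eta=\eta'i$ with $\phi(\eta')=(f,L)$: $\phi[d](\eta)=\phi[d](\eta')\circ f_L$ if $i=1$, $\phi[d](\eta')\circ f_L^*$ if $i=2$. For finite $T$, $\mu_{\phi[d]}(\mathcal{C})=\sum_{\eta\in L(T\uparrow),\phi[d](\eta)\in\mathcal{C}}2^{-|\eta|}$. $d\ll_{\mathcal{F}}\mathcal{C}$ means there are finite binary trees $T_0\subseteq T_1\subseteq\cdots$ and $\phi_n\colon T_n\to\mathcal{F}$ with $\phi_{n+1}|_{T_n}=\phi_n$ and $\mu_{\phi_n[d]}(\mathcal{C})\to1$. $G$ is $\mathcal{F}$-left-cut-percolating if there are $V_0,\dots,V_n\subseteq V_1(G)$ with $|V_0|=1$, $V_n=V_1(G)$, and for each $i\in[n]$ some $(f,L)\in\mathcal{F}$ with $V_i=f_L^{-1}(V_{i-1})$. Fold-stability, for $K\le\mathrm{Aut}(G)$, $\mathcal{F},\mathcal{F}'\subseteq\mathrm{Fold}(G)$ and a coloring $d$: $d$ is $(K,\mathcal{F})$-fold-stable if for every $(f,L)\in\mathcal{F}$ some $g\in K$ is an isomorphism from $(G,d)$ to $(G,d\circ f_L)$; $\mathcal{F}'$-strongly $(K,\mathcal{F})$-fold-stable if moreover for every $(f,L)\in\mathcal{F}$ there is $h\in\mathrm{Aut}((G,d))$ with $\mathrm{Fix}(h)=\mathrm{Fix}(f)$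 and $(h,L)\in\mathcal{F}'$. $\ell\otimes c$ is $\mathcal{F}'$-left-symmetrically $(K,\mathcal{F})$-fold-stable if it is $\mathcal{F}'$-strongly $(K,\mathcal{F})$-fold-stable and for all $i,j\in\mathrm{im}(\ell)$ there are $g\in K$ and a permutation $\sigma$ of $C$ with $\sigma(i)=j$ and $g$ an isomorphism from $(G,\ell\otimes c)$ to $(G,(\sigma\circ\ell)\otimes c)$.
   Formalization: The formal theorem additionally assumes that V_1(G) is nonempty; if V_1(G) is empty (G a single vertex in V_2), (1) fails while (2) holds, so the equivalence is false there. *)

(* Defs.v *)
From mathcomp Require Import all_boot all_order all_algebra all_fingroup.
From mathcomp Require Import finmap.
From mathcomp Require Import boolp classical_sets reals topology normedtype.
From mathcomp Require Import sequences.
(* Finite sets take precedence over the homonymous classical sets. *)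
From mathcomp Require Import fintype finset.

Set Implicit Arguments.
Unset Strict Implicit.
Unset Printing Implicit Defensive.

Import Order.TTheory GRing.Theory Num.Theory.
Import numFieldNormedType.Exports.

Record bigraph := Bigraph {
  vertex :> finType;
  V1 : {set vertex};
  V2 : {set vertex};
  E : {set vertex * vertex};
  V12_disjoint : [disjoint V1 & V2];
  V12_cover : V1 :|: V2 = [set: vertex];
  E_sub : E \subset setX V1 V2
}.

Section Bigraph.
Variable G : bigraph.

Definition edge := {e : G * G | e \in E G}.

Definition lvertex := {v : G | v \in V1 G}.

Lemma edge_left (e : edge) : (val e).1 \in V1 G.
Proof.
by have /(subsetP (@E_sub G)) := valP e; case: (val e) => u v /setXP[].
Qed.

Definition lend (e : edge) : lvertex := exist _ (val e).1 (edge_left e).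

Definition is_endo (phi : G -> G) :=
  forall u v, (u, v) \in E G -> (phi u, phi v) \in E G.

(* The default value [e] is irrelevant: [edge_map] is only applied to           *)
(* automorphisms and folding maps, which are endomorphisms (see [aut_endo],     *)
(* [fold_map_endo] and [fold_map_star_endo]).                                   *)
Definition edge_map (phi : G -> G) (e : edge) : edge :=
  insubd e (phi (val e).1, phi (val e).2).

Lemma val_edge_map (phi : G -> G) (e : edge) :
  is_endo phi -> val (edge_map phi e) = (phi (val e).1, phi (val e).2).
Proof.
move=> endo; rewrite val_insubd endo //.
by have := valP e; case: (val e).
Qed.

Definition precomp (D : Type) (d : edge -> D) (phi : G -> G) : edge -> D :=
  fun e => d (edge_map phi e).

Definition adj : rel G := fun u v => ((u, v) \in E G) || ((v, u) \in E G).

Definition adj_minus (S : {set G}) : rel G :=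
  fun u v => [&& u \notin S, v \notin S & adj u v].

(* Vacuously true for the empty graph, which is thus not disconnected. *)
Definition connected_minus (S : {set G}) : bool :=
  [forall u in ~: S, forall v in ~: S, connect (adj_minus S) u v].

Definition connected : bool := connected_minus set0.

Definition is_cut (S : {set G}) : bool := ~~ connected_minus S.

Definition components (S : {set G}) : {set {set G}} :=
  [set [set v | connect (adj_minus S) u v] | u in ~: S].

Definition Aut_bg : {set {perm G}} :=
  [set h : {perm G} | [&& h @: V1 G == V1 G, h @: V2 G == V2 G
    & [forall u, forall v, ((u, v) \in E G) == ((h u, h v) \in E G)]]].

Definition Fix (f : {perm G}) : {set G} := [set v | f v == v].

Definition cut_involution (f : {perm G}) : bool :=
  [&& f \in Aut_bg, [forall v, f (f v) == v] & is_cut (Fix f)].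

Definition prefold := ({perm G} * {set G})%type.

Definition Fold : {set prefold} :=
  [set F : prefold | let: (f, L) := F in
    [&& cut_involution f,
        [exists P : {set {set G}},
          (P \subset components (Fix f)) && (L == cover P)],
        [disjoint L & Fix f], [disjoint L & f @: L],
        [disjoint Fix f & f @: L]
      & L :|: Fix f :|: f @: L == [set: G]]].

Definition dual_fold (F : prefold) : prefold := (F.1, F.1 @: F.2).

Definition fold_map (F : prefold) (v : G) : G :=
  if v \in F.2 then v else F.1 v.

Definition fold_map_star (F : prefold) (v : G) : G :=
  if v \in F.2 then F.1 v else v.

Lemma aut_endo (h : {perm G}) : h \in Aut_bg -> is_endo h.
Proof.
by rewrite inE => /and3P[_ _ /forallP eqE] u v; move/forallP: (eqE u) => /(_ v)/eqP->.
Qed.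

Lemma precomp_comp (D : Type) (d : edge -> D) (phi psi : G -> G) :
  is_endo phi -> is_endo psi ->
  precomp (precomp d phi) psi = precomp d (phi \o psi).
Proof.
move=> ephi epsi; apply/funext => e; congr (d _); apply: val_inj.
rewrite !val_edge_map //= => u v uv; exact/ephi/epsi.
Qed.

Lemma precomp_id (D : Type) (d : edge -> D) (phi : G -> G) :
  phi =1 id -> precomp d phi = d.
Proof.
move=> phiE; apply/funext => e; congr (d _); apply: val_inj.
rewrite val_edge_map => [|u v]; rewrite !phiE //; by case: (val e).
Qed.

Lemma fold_adj_side (f : {perm G}) (L : {set G}) (u v : G) :
  (f, L) \in Fold -> adj u v -> u \in L -> v \notin L -> f v = v.
Proof.
rewrite inE => /and5P[_ /existsP[P /andP[/subsetP sP /eqP LE]] dF _ _] uv uL vL.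
apply/eqP/negPn/negP => fv; case/negP: vL.
have := uL; rewrite LE => /bigcupP[B BP uB]; apply/bigcupP; exists B => //.
have /imsetP[w _ BE] := sP _ BP.
move: uB; rewrite BE !inE => wu; apply: connect_trans wu (connect1 _).
by have := disjointFr dF uL; rewrite /adj_minus !inE fv uv => ->.
Qed.

Lemma fold_map_endo (F : prefold) : F \in Fold -> is_endo (fold_map F).
Proof.
case: F => f L FF u v uv; rewrite /fold_map /=.
have /aut_endo fE : f \in Aut_bg by move: FF; rewrite inE => /andP[/and3P[]].
have auv : adj u v by rewrite /adj uv.
have avu : adj v u by rewrite /adj uv orbT.
case: ifPn => uL; case: ifPn => vL //; last exact: fE.
  by rewrite (fold_adj_side FF auv).
by rewrite (fold_adj_side FF avu).
Qed.

Lemma fold_map_star_endo (F : prefold) :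
  F \in Fold -> is_endo (fold_map_star F).
Proof.
case: F => f L FF u v uv; rewrite /fold_map_star /=.
have /aut_endo fE : f \in Aut_bg by move: FF; rewrite inE => /andP[/and3P[]].
have auv : adj u v by rewrite /adj uv.
have avu : adj v u by rewrite /adj uv orbT.
have := fE _ _ uv; case: ifPn => uL; case: ifPn => vL //.
  by rewrite (fold_adj_side FF auv).
by rewrite (fold_adj_side FF avu).
Qed.

Definition isomorphism (D : Type) (g : {perm G}) (d d' : edge -> D) : Prop :=
  g \in Aut_bg /\ precomp d' g = d.

Definition Aut_col (D : Type) (d : edge -> D) : {set {perm G}} :=
  [set g : {perm G} | `[< isomorphism g d d >]].

Lemma Aut_bg_group_set : group_set Aut_bg.
Proof.
apply/group_setP; split.
  rewrite inE; apply/and3P; split; try (apply/eqP/setP => v; apply/imsetP/idP).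
  - by case=> w wV ->; rewrite perm1.
  - by move=> vV; exists v; rewrite ?perm1.
  - by case=> w wV ->; rewrite perm1.
  - by move=> vV; exists v; rewrite ?perm1.
  by apply/forallP => u; apply/forallP => v; rewrite !perm1.
move=> g h; rewrite !inE => /and3P[/eqP g1 /eqP g2 /forallP gE].
move=> /and3P[/eqP h1 /eqP h2 /forallP hE].
have im (A : {set G}) : (g * h)%g @: A = h @: (g @: A).
  by rewrite -imset_comp; apply: eq_imset => v; rewrite /= permM.
rewrite !im g1 g2 h1 h2 !eqxx; apply/forallP => u; apply/forallP => v.
rewrite !permM (eqP (forallP (gE u) v)); exact: (forallP (hE _) _).
Qed.
Canonical Aut_bg_group := Group Aut_bg_group_set.

Lemma Aut_col_group_set (D : Type) (d : edge -> D) : group_set (Aut_col d).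
Proof.
apply/group_setP; split.
  rewrite inE; apply/asboolP; split; first exact: group1.
  by apply: precomp_id => v; rewrite perm1.
move=> g h; rewrite !inE => /asboolP[gA gd] /asboolP[hA hd].
apply/asboolP; split; first exact: groupM.
rewrite -{2}gd -{2}hd precomp_comp; [|exact: aut_endo..].
by congr precomp; apply/funext => v; rewrite permM.
Qed.
Canonical Aut_col_group (D : Type) (d : edge -> D) :=
  Group (Aut_col_group_set d).

Definition Fold_col (D : Type) (d : edge -> D) : {set prefold} :=
  [set F in Fold | F.1 \in Aut_col d].

(* Permutations compose left to right: [h^-1 * f * h] maps [v] to               *)
(* [h (f (h^-1 v))].                                                            *)
Definition invariant_folds (K : {group {perm G}}) (FF : {set prefold}) : Prop :=
  forall h F, h \in K -> F \in FF -> ((h^-1 * F.1 * h)%g, h @: F.2) \in FF.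

Definition left_vertex_transitive (K : {group {perm G}}) : Prop :=
  forall u v, u \in V1 G -> v \in V1 G -> exists2 h, h \in K & h u = v.

Definition monochromatic (C : Type) (l : lvertex -> C) : Prop :=
  forall u v, l u = l v.

Definition rainbow (C : Type) (l : lvertex -> C) : Prop := injective l.

Definition tensor (C C' : Type) (l : lvertex -> C) (c : edge -> C') :
  edge -> C * C' := fun e => (l (lend e), c e).

Definition mono_tensors (C C' : Type) (c : edge -> C') : set (edge -> C * C') :=
  fun d => exists2 l : lvertex -> C, monochromatic l & d = tensor l c.

Definition reach (D : Type) (FF : {set prefold}) (d d' : edge -> D) : Prop :=
  exists2 s : seq prefold,
    (forall F, F \in s -> F \in Fold /\ (F \in FF \/ dual_fold F \in FF)) &
    d' = foldl (fun a F => precomp a (fold_map F)) d s.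

Definition reach_set (D : Type) (FF : {set prefold}) (d : edge -> D)
  (CC : set (edge -> D)) : Prop := exists2 d', CC d' & reach FF d d'.

Definition maximal (D : Type) (FF : {set prefold}) (d : edge -> D) : Prop :=
  forall d', reach FF d d' -> reach FF d' d.

(* Strings over {1, 2}: the symbol 1 is [false] and the symbol 2 is [true].     *)
Notation string := (seq bool).

Definition binary_tree (T : {fset string}) : Prop :=
  forall s t : string, prefix s t -> t \in T -> s \in T.

Definition tree_up (T : {fset string}) : {fset string} :=
  ([fset [::]] `|` [fset rcons s i | s in T, i in [fset false; true]])%fset.

Definition leaves (T : {fset string}) : {fset string} :=
  [fset s in T | all (fun t => prefix s t ==> (t == s)) T]%fset.

Definition fold_step (F : prefold) (i : bool) : G -> G :=
  if i then fold_map_star F else fold_map F.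

(* A folding tree on [T] is given by a total function on strings, of which      *)
(* only the values on [T] matter.                                               *)
Fixpoint tree_col_from (D : Type) (phi : string -> prefold) (s : string)
    (d : edge -> D) (t : string) : edge -> D :=
  if t is i :: t' then
    tree_col_from phi (rcons s i) (precomp d (fold_step (phi s) i)) t'
  else d.

Definition tree_col (D : Type) (phi : string -> prefold) (d : edge -> D) :
  string -> edge -> D := tree_col_from phi [::] d.

Lemma tree_col_nil (D : Type) (phi : string -> prefold) (d : edge -> D) :
  tree_col phi d [::] = d.
Proof. by []. Qed.

Lemma tree_col_rcons (D : Type) (phi : string -> prefold) (d : edge -> D)
    (s : string) (i : bool) :
  tree_col phi d (rcons s i) =
  precomp (tree_col phi d s) (fold_step (phi s) i).
Proof.
suff H t s0 (a : edge -> D) : tree_col_from phi s0 a (rcons t i) =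
    precomp (tree_col_from phi s0 a t) (fold_step (phi (s0 ++ t)) i).
  exact: H.
by elim: t s0 a => [|j t IH] s0 a /=; rewrite ?cats0 // IH cat_rcons.
Qed.

Definition mu (R : realType) (D : Type) (T : {fset string})
    (phi : string -> prefold) (d : edge -> D) (CC : set (edge -> D)) : R :=
  (\sum_(s <- leaves (tree_up T) | `[< CC (tree_col phi d s) >])
     2%:R ^- size s)%R.

Definition percolates_to (R : realType) (D : Type) (FF : {set prefold})
    (d : edge -> D) (CC : set (edge -> D)) : Prop :=
  exists (T : nat -> {fset string}) (phi : nat -> string -> prefold),
    [/\ forall n, binary_tree (T n),
        forall n, (T n `<=` T n.+1)%fset,
        forall n s, s \in T n -> phi n s \in FF,
        forall n s, s \in T n -> phi n.+1 s = phi n s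
      & ((fun n => mu R (T n) (phi n) d CC) @ \oo --> (1 : R)%R)%classic].

Definition left_cut_percolating (FF : {set prefold}) : Prop :=
  exists (n : nat) (W : nat -> {set G}),
    [/\ forall i, i <= n -> W i \subset V1 G,
        #|W 0| = 1,
        W n = V1 G
      & forall i, i < n ->
          exists2 F, F \in FF & W i.+1 = fold_map F @^-1: W i].

Definition fold_stable (D : Type) (K : {group {perm G}}) (FF : {set prefold})
    (d : edge -> D) : Prop :=
  forall F, F \in FF ->
    exists2 g, g \in K & isomorphism g d (precomp d (fold_map F)).

Definition strongly_fold_stable (D : Type) (FF' : {set prefold})
    (K : {group {perm G}}) (FF : {set prefold}) (d : edge -> D) : Prop :=
  fold_stable K FF d /\
  forall F, F \in FF -> exists h,
    [/\ h \in Aut_col d, Fix h = Fix F.1 & (h, F.2) \in FF'].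

Definition left_symmetrically_fold_stable (C C' : Type) (FF' : {set prefold})
    (K : {group {perm G}}) (FF : {set prefold})
    (l : lvertex -> C) (c : edge -> C') : Prop :=
  strongly_fold_stable FF' K FF (tensor l c) /\
  forall i j, range l i -> range l j -> exists g (sigma : C -> C),
    [/\ g \in K, bijective sigma, sigma i = j
      & isomorphism g (tensor l c) (tensor (sigma \o l) c)].

Definition fold_group (FF : {set prefold}) : {group {perm G}} :=
  <<[set F.1 | F in FF]>>%G.

End Bigraph.

Arguments mono_tensors {G} C {C'} c.

(* Main.v *)
From mathcomp Require Import finmap topology normedtype sequences.
Require Import Defs.
From mathcomp Require Import all_boot all_order all_algebra all_fingroup.
From mathcomp Require Import boolp classical_sets reals.
From mathcomp Require Import fintype finset.

Set Implicit Arguments.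
Unset Strict Implicit.
Unset Printing Implicit Defensive.

Import Order.TTheory GRing.Theory Num.Theory.
Import numFieldNormedType.Exports.

(* A word in the folds of [FF] acts on left-colorings by precomposition, and    *)
(* (1), (2), (3) all say that some word collapses [V1 G] to a point. Repeating  *)
(* such a word along complete binary trees gives (4). If [l] is fold-stable,    *)
(* conjugating folds by automorphisms shows that every coloring reachable from  *)
(* [l] is isomorphic to [l], so a collapsing word forces [l] to be              *)
(* monochromatic. Conversely, a maximal coloring [d] is strongly fold-stable:   *)
(* writing [L'] for the dual of [L], the inequality 2 |Hom(d)| <= |Hom(d f_L)|  *)
(* + |Hom(d f_L')| holds for all targets by Cauchy-Schwarz; the coloring with   *)
(* most homomorphisms among those reachable from [d], and hence every one of    *)
(* them, gives equality, so the two halves of [d] have the same number of       *)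
(* homomorphisms to every target rooted at [Fix f], and are therefore           *)
(* isomorphic relative to [Fix f]. Maximal colorings are obtained from words of *)
(* minimal rank; if such a word [e] is idempotent, the rainbow coloring         *)
(* precomposed with [e] is moreover left-symmetric.                             *)

(** * Automorphisms and folds *)

(** The nine statements form a cycle of implications whose pivot is the existence of a [collapsing]
    word. An injective coloring remembers the word map, so (3) already provides such a word
    ([rainbow_reach_collapsing]), and (5) leads back to (3) because positive mass needs a leaf in
    the target set ([percolates_reach]). A collapsing word gives (6) by [fold_stable_monochromatic];
    (7) is a weakening, and (8) follows since maximality implies strong fold-stability
    ([maximal_strongly_fold_stable]), whose engine is the equality case of [leqif_card_homs].

    To return from (8) or (9), take a word that shrinks [V1 G] as far as possible. It turns every
    left-coloring into a maximal one ([min_word_maximal]) and, if it is idempotent and the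
    automorphisms are transitive on [V1 G], the rainbow coloring into a left-symmetric one
    ([min_word_left_symmetric]). That the resulting coloring is monochromatic then says that the
    word collapses. *)

Section Automorphisms.
Variable G : bigraph.
Implicit Types (u v : G) (h p : {perm G}) (phi psi : G -> G).

Lemma V2_setC : V2 G = ~: V1 G.
Proof.
apply/setP => v; rewrite inE; have := in_setT v; rewrite -V12_cover inE.
by case: (boolP (v \in V1 G)) => [/(disjointFr (V12_disjoint G))->|].
Qed.

Lemma aut_V1 h v : h \in Aut_bg G -> (h v \in V1 G) = (v \in V1 G).
Proof.
by rewrite inE => /and3P[/eqP h1 _ _]; rewrite -{1}h1 mem_imset //; apply: perm_inj.
Qed.

(** By finiteness, an injection of [E G] into itself is onto, so edges are reflected as well as
    preserved. *)
Lemma perm_aut p : is_endo p -> (forall v, (p v \in V1 G) = (v \in V1 G)) ->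
  p \in Aut_bg G.
Proof.
move=> pE p1; rewrite inE; have ep (A : {set G}) :
    (forall v, (p v \in A) = (v \in A)) -> p @: A == A.
  move=> pA; rewrite eqEcard card_imset ?leqnn ?andbT; last exact: perm_inj.
  by apply/subsetP => _ /imsetP[v vA ->]; rewrite pA.
rewrite !ep //=; last by move=> v; rewrite V2_setC !inE p1.
pose pp (e : G * G) := (p e.1, p e.2).
have ppI : injective pp by move=> [a b] [a' b'] [/perm_inj-> /perm_inj->].
have ppE : pp @: E G = E G.
  apply/eqP; rewrite eqEcard card_imset // leqnn andbT.
  by apply/subsetP => _ /imsetP[[u v] uv ->]; apply: pE.
apply/forallP => u; apply/forallP => v; apply/eqP.
by rewrite -[in RHS]ppE -[(p u, p v)]/(pp (u, v)) mem_imset.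
Qed.

Lemma eq_edge_map phi psi (e : edge G) :
  phi (val e).1 = psi (val e).1 -> phi (val e).2 = psi (val e).2 ->
  edge_map phi e = edge_map psi e.
Proof. by rewrite /edge_map => -> ->. Qed.

Lemma edge_map_id phi (e : edge G) :
  phi (val e).1 = (val e).1 -> phi (val e).2 = (val e).2 -> edge_map phi e = e.
Proof.
by rewrite /edge_map => -> ->; apply: val_inj; rewrite val_insubd -surjective_pairing (valP e).
Qed.

End Automorphisms.

Section Folds.
Variable G : bigraph.
Implicit Types (u v : G) (h p : {perm G}) (F : prefold G).

Lemma fold_aut F : F \in Fold G -> F.1 \in Aut_bg G.
Proof. by case: F => f L; rewrite inE => /andP[/and3P[]]. Qed.

Lemma fold_involutive F : F \in Fold G -> involutive F.1.
Proof.
by case: F => f L; rewrite inE => /andP[/and3P[_ /forallP fK _] _] v; apply/eqP.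
Qed.

Lemma fold_swap F v : F \in Fold G -> v \in F.2 -> F.1 v \notin F.2.
Proof.
case: F => f L FF /= vL; move: FF; rewrite inE => /and5P[_ _ _ dL _].
by rewrite (disjointFl dL) // imset_f.
Qed.

Lemma fold_moved F v : F \in Fold G -> v \in F.2 -> F.1 v != v.
Proof. by move=> FF vL; apply: contraTneq (vL) => <-; apply: fold_swap. Qed.

Lemma fold_opposite F v :
  F \in Fold G -> v \notin F.2 -> F.1 v \notin F.2 -> F.1 v = v.
Proof.
case: F => f L FF /= vL fvL; have /= fK := fold_involutive FF.
move: FF; rewrite inE => /and5P[_ _ _ _ /andP[_ /eqP LT]].
have := in_setT v; rewrite -LT !inE (negPf vL) /= => /orP[/eqP//|].
by case/imsetP => w wL vE; move: fvL; rewrite vE fK wL.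
Qed.

Lemma fold_mapE F v : F \in Fold G -> fold_map F (F.1 v) = fold_map F v.
Proof.
move=> FF; rewrite /fold_map; case: ifPn => fvL.
  by case: ifPn => // vL; have := fold_swap FF vL; rewrite fvL.
rewrite (fold_involutive FF); case: ifPn => // vL.
by rewrite (fold_opposite FF).
Qed.

Lemma fold_map_idem F v : F \in Fold G -> fold_map F (fold_map F v) = fold_map F v.
Proof. by move=> FF; rewrite {2}/fold_map; case: ifP => // _; apply: fold_mapE. Qed.

Lemma fold_map_starE F v :
  F \in Fold G -> fold_map_star F v = F.1 (fold_map F v).
Proof.
move=> FF; rewrite /fold_map_star /fold_map; case: ifPn => //.
by rewrite (fold_involutive FF).
Qed.

Lemma fold_map_fixed F v : F.1 v = v -> fold_map F v = v.
Proof. by rewrite /fold_map => ->; rewrite if_same. Qed.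

(** Lets the second branch of a percolation step, and the second half of a fold, be treated as a
    fold too. *)
Lemma fold_map_dual F : F \in Fold G -> fold_map (dual_fold F) = fold_map_star F.
Proof.
move=> FF; apply/funext => v; rewrite /fold_map /fold_map_star /=.
have -> : (v \in F.1 @: F.2) = (F.1 v \in F.2).
  by rewrite -{1}(fold_involutive FF v) mem_imset //; apply: perm_inj.
case: ifPn => fvL; case: ifPn => vL //.
  by have := fold_swap FF vL; rewrite fvL.
exact: fold_opposite.
Qed.

Lemma dual_foldK F : F \in Fold G -> dual_fold (dual_fold F) = F.
Proof.
move=> FF; case: F FF => f L FF; rewrite /dual_fold /= -imset_comp; congr pair.
by rewrite -[RHS]imset_id; apply: eq_imset => v; apply: (fold_involutive FF).
Qed.

Lemma fold_map_V1 F v : F \in Fold G -> (fold_map F v \in V1 G) = (v \in V1 G).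
Proof. by move=> FF; rewrite /fold_map; case: ifP => // _; rewrite aut_V1 ?fold_aut. Qed.

(** No edge joins [L] to [f(L)], because [L] is a union of components. This is what allows maps to
    be glued along [Fix f]. *)
Lemma fold_edge_side F u v : F \in Fold G -> (u, v) \in E G ->
  (fold_map F u = u /\ fold_map F v = v) \/ (u \notin F.2 /\ v \notin F.2).
Proof.
case: F => f L FF uv; rewrite /fold_map /=.
have auv : adj u v by rewrite /adj uv.
have avu : adj v u by rewrite /adj uv orbT.
case: ifPn => uL; case: ifPn => vL; [by left|left|left|by right].
  by rewrite (fold_adj_side FF auv).
by rewrite (fold_adj_side FF avu).
Qed.

Lemma fold_map_conj F h v :
  fold_map ((h^-1 * F.1 * h)%g, h @: F.2) v = h (fold_map F (h^-1%g v)).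
Proof.
rewrite /fold_map /= !permM -{1}(permKV h v) mem_imset; last exact: perm_inj.
by case: ifP => // _; rewrite permKV.
Qed.

End Folds.

(** * Fiber products and counting maps by their image *)

Section FiberProducts.

Lemma card_fiber_product (A B : finType) (rho : A -> B) (P Q : {set A}) :
  #|[set ab in setX P Q | rho ab.1 == rho ab.2]| =
  \sum_psi #|[set a in P | rho a == psi]| * #|[set b in Q | rho b == psi]|.
Proof.
rewrite -sum1_card (partition_big (fun ab => rho ab.1) xpredT) //=.
apply: eq_bigr => psi _; rewrite -cardsX -sum1_card; apply: eq_bigl => -[a b].
rewrite !inE /=; case: (a \in P); case: (b \in Q); rewrite ?andbF //=.
by rewrite andbC; case: eqP => //= ->; rewrite eq_sym.
Qed.

(** Sum over [psi] of 2xy <= x^2 + y^2, where x and y are the sizes of the fibers of [P] and [Q];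
    equality forces x = y in every fiber. *)
Lemma leqif_fiber_product (A B : finType) (rho : A -> B) (P Q : {set A}) :
  2 * #|[set ab in setX P Q | rho ab.1 == rho ab.2]| <=
  #|[set ab in setX P P | rho ab.1 == rho ab.2]| +
  #|[set ab in setX Q Q | rho ab.1 == rho ab.2]|
  ?= iff [forall psi, #|[set a in P | rho a == psi]| ==
                      #|[set b in Q | rho b == psi]|].
Proof.
rewrite !card_fiber_product big_distrr -big_split /=.
apply: leqif_sum => psi _; exact: nat_Cauchy.
Qed.

(** Maps into [S] split according to their image; the images strictly inside [S] cancel by induction
    on the size of [S]. *)
Lemma card_exact_image (A B : finType) (P Q : {set {ffun A -> B}}) :
  (forall S : {set B}, #|[set a in P | [forall x, a x \in S]]| =
                       #|[set b in Q | [forall x, b x \in S]]|) ->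
  forall S : {set B}, #|[set a in P | a @: setT == S]| =
                      #|[set b in Q | b @: setT == S]|.
Proof.
move=> PQ S; have [n] := ubnP #|S|; elim: n S => // n IH S /ltnSE Sn.
have decomp (X : {set {ffun A -> B}}) :
    #|[set a in X | [forall x, a x \in S]]| =
    #|[set a in X | a @: setT == S]| +
    \sum_(T : {set B} | T \proper S) #|[set a in X | a @: setT == T]|.
  rewrite -sum1_card (partition_big (fun a : {ffun A -> B} => a @: setT)
    (fun T : {set B} => T \subset S)) /=; last first.
    move=> a; rewrite inE => /andP[_ /forallP aS].
    by apply/subsetP => _ /imsetP[x _ ->].
  have sumE (T : {set B}) : T \subset S ->
      \sum_(a in [set a in X | [forall x, a x \in S]] | a @: setT == T) 1 =
      #|[set a in X | a @: setT == T]|.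
    move=> TS; rewrite -sum1_card; apply: eq_bigl => a; rewrite !inE -andbA.
    congr andb; apply: andb_idl => /eqP aT; apply/forallP => x.
    by apply: (subsetP TS); rewrite -aT imset_f.
  rewrite (bigD1 S) //= sumE //; congr addn.
  rewrite (eq_bigl (fun T : {set B} => T \proper S)); last first.
    by move=> T; rewrite properEneq andbC.
  by apply: eq_bigr => T /proper_sub; apply: sumE.
apply/eqP; rewrite -(eqn_add2r
  (\sum_(T : {set B} | T \proper S) #|[set a in P | a @: setT == T]|)) -decomp.
rewrite PQ decomp; apply/eqP; congr addn; apply: eq_bigr => T TS.
by rewrite IH // (leq_trans (proper_card TS)).
Qed.

End FiberProducts.

(** * Counting homomorphisms *)

Section Homomorphisms.
Variables (G : bigraph) (D : Type).
Implicit Types (F : prefold G) (S : {set G}) (a d : edge G -> D).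

(** Color- and side-preserving homomorphisms from [(G, a)] to the part of [(G, d0)] induced on [S].
    Varying [S] supplies all the targets needed without leaving [G]. *)
Definition homs d0 S a : {set {ffun G -> G}} :=
  [set phi : {ffun G -> G} | [forall v, phi v \in S] &&
    `[< [/\ is_endo phi, (forall v, (phi v \in V1 G) = (v \in V1 G))
          & precomp d0 phi = a] >]].

(** Homomorphisms of the half of [(G, a)] on [L] and [Fix f], encoded as the [f]-symmetric
    homomorphisms of the folded coloring. *)
Definition symhoms d0 F S a : {set {ffun G -> G}} :=
  [set phi in homs d0 S (precomp a (fold_map F)) |
    [forall v, phi (F.1 v) == phi v]].

(** The root data of a half: filling in the identity off [Fix f] keeps restrictions in one finite
    type. *)
Definition fix_restrict F (phi : {ffun G -> G}) : {ffun G -> G} :=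
  [ffun v => if F.1 v == v then phi v else v].

Lemma homsP d0 S a (phi : {ffun G -> G}) :
  reflect [/\ forall v, phi v \in S, is_endo phi,
              forall v, (phi v \in V1 G) = (v \in V1 G)
            & precomp d0 phi = a]
          (phi \in homs d0 S a).
Proof.
rewrite inE; apply: (iffP andP) => [[/forallP ? /asboolP[? ? ?]]|[? ? ? ?]].
  by split.
by split; [apply/forallP | apply/asboolP; split].
Qed.

Lemma symhomsP d0 F S a (phi : {ffun G -> G}) :
  reflect (phi \in homs d0 S (precomp a (fold_map F)) /\
           forall v, phi (F.1 v) = phi v)
          (phi \in symhoms d0 F S a).
Proof.
rewrite !inE; apply: (iffP andP) => [[-> /forallP phiF]|[-> phiF]]; split=> //.
  by move=> v; apply/eqP.
by apply/forallP => v; apply/eqP.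
Qed.

Lemma fix_restrictP F (phi psi : {ffun G -> G}) :
  fix_restrict F phi = fix_restrict F psi <->
  forall v, F.1 v = v -> phi v = psi v.
Proof.
split=> [/ffunP eqF v fv|eqF]; first by have := eqF v; rewrite !ffunE fv eqxx.
by apply/ffunP => v; rewrite !ffunE; case: eqP => // /eqF.
Qed.

Lemma eq_symhoms d0 F S a a' :
  precomp a (fold_map F) = precomp a' (fold_map F) ->
  symhoms d0 F S a = symhoms d0 F S a'.
Proof. by rewrite /symhoms => ->. Qed.

Lemma precomp_fold_idem F a : F \in Fold G ->
  precomp (precomp a (fold_map F)) (fold_map F) = precomp a (fold_map F).
Proof.
move=> FF; rewrite precomp_comp; try exact: fold_map_endo.
by congr precomp; apply/funext => v; apply: fold_map_idem.
Qed.

Lemma precomp_fold_star F a : F \in Fold G ->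
  precomp a (fold_map_star F) = precomp (precomp a F.1) (fold_map F).
Proof.
move=> FF; rewrite precomp_comp; [|exact/aut_endo/fold_aut|exact: fold_map_endo].
by congr precomp; apply/funext => v; apply: fold_map_starE.
Qed.

(* A homomorphism [phi] is cut along [Fix f] into its two halves, which are     *)
(* stored as the symmetric maps [phi \o f_L] and [phi \o f_L^*].                *)
Lemma card_homs d0 F S a : F \in Fold G ->
  #|homs d0 S a| =
  #|[set ab in setX (symhoms d0 F S a) (symhoms d0 F S (precomp a F.1)) |
     fix_restrict F ab.1 == fix_restrict F ab.2]|.
Proof.
move=> FF.
pose halves (phi : {ffun G -> G}) : {ffun G -> G} * {ffun G -> G} :=
  ([ffun v => phi (fold_map F v)], [ffun v => phi (fold_map_star F v)]).
have halves_inj : injective halves.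
  move=> phi psi [/ffunP eq1 /ffunP eq2]; apply/ffunP => v.
  have := eq1 v; have := eq2 v; rewrite !ffunE /fold_map /fold_map_star.
  by case: ifP.
have eF := fold_map_endo FF; have eF' := fold_map_star_endo FF.
have ffE (phi psi : G -> G) : [ffun v => phi (psi v)] = phi \o psi :> (G -> G).
  by apply/funext => v; rewrite ffunE.
rewrite -(card_imset (homs d0 S a) halves_inj); congr #|pred_of_set _|.
apply/setP => -[al be]; apply/imsetP/idP => [[phi /homsP[pS pE p1 pa]]|].
  move=> [-> ->]; rewrite inE in_setX /=; apply/andP; split; last first.
    apply/eqP/fix_restrictP => v fv; rewrite !ffunE fold_map_starE //.
    by rewrite fold_map_fixed ?fv.
  apply/andP; split; apply/symhomsP; split.
  - apply/homsP; split; first (by move=> v; rewrite ffunE); rewrite ffE.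
    + by move=> u v /eF/pE.
    + by move=> v; rewrite /= p1 fold_map_V1.
    + by rewrite -precomp_comp // pa.
  - by move=> v; rewrite !ffunE fold_mapE.
  - apply/homsP; split; first (by move=> v; rewrite ffunE); rewrite ffE.
    + by move=> u v /eF'/pE.
    + move=> v; rewrite /= p1 fold_map_starE // aut_V1 ?fold_aut //.
      exact: fold_map_V1.
    + by rewrite -precomp_comp // pa precomp_fold_star.
  - by move=> v; rewrite !ffunE !fold_map_starE // fold_mapE.
rewrite inE in_setX /= => /andP[/andP[/symhomsP[/homsP[aS aE a1 aa] aF]]].
move=> /symhomsP[/homsP[bS bE b1 ba] bF] /eqP/fix_restrictP abF.
(* The halves agree on [Fix f], so the gluing is consistent; [fold_edge_side] puts every edge inside
   one half. *)
pose phi := [ffun v => if v \in F.2 then al v else be v].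
have phi_al v : fold_map F v = v -> phi v = al v.
  rewrite /fold_map ffunE; case: ifP => // _ fv; exact/esym/abF.
have phi_be v : v \notin F.2 -> phi v = be v by rewrite ffunE => /negPf->.
exists phi.
  apply/homsP; split.
  - by move=> v; rewrite ffunE; case: ifP.
  - move=> u v uv; case: (fold_edge_side FF uv) => [[fu fv]|[fu fv]].
      by rewrite !phi_al //; apply: aE.
    by rewrite !phi_be //; apply: bE.
  - by move=> v; rewrite ffunE; case: ifP; rewrite ?a1 ?b1.
  apply/funext => e; have uv : ((val e).1, (val e).2) \in E G.
    by rewrite -surjective_pairing (valP e).
  rewrite /precomp; case: (fold_edge_side FF uv) => [[fu fv]|[fu fv]].
    rewrite (@eq_edge_map _ phi al) ?phi_al //.
    have := congr1 (@^~ e) aa; rewrite /precomp => ->.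
    by rewrite edge_map_id.
  rewrite (@eq_edge_map _ phi be) ?phi_be //.
  have := congr1 (@^~ e) ba; rewrite -precomp_fold_star // /precomp => ->.
  by rewrite edge_map_id // /fold_map_star (negPf fu, negPf fv).
congr pair; apply/ffunP => v; rewrite ffunE.
  by rewrite phi_al ?fold_map_idem // /fold_map; case: ifP.
rewrite phi_be /fold_map_star; first by case: ifP.
by case: ifPn => // vL; apply: fold_swap.
Qed.

(** If A and B are the sets of maps of the two halves, the three counts are the fiber products A x
    B, A x A and B x B over the restrictions to [Fix f]. *)
Lemma leqif_card_homs d0 F S a : F \in Fold G ->
  2 * #|homs d0 S a| <=
  #|homs d0 S (precomp a (fold_map F))| +
  #|homs d0 S (precomp a (fold_map_star F))|
  ?= iff [forall psi,
    #|[set al in symhoms d0 F S a | fix_restrict F al == psi]| ==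
    #|[set be in symhoms d0 F S (precomp a F.1) | fix_restrict F be == psi]|].
Proof.
move=> FF; rewrite !(card_homs d0 S _ FF).
have fE : is_endo F.1 by exact/aut_endo/fold_aut.
have FE := fold_map_endo FF.
(* A folded coloring is symmetric, so both of its halves carry the same maps. *)
have flip (b : edge G -> D) : precomp (precomp (precomp b (fold_map F)) F.1) (fold_map F) =
    precomp b (fold_map F).
  rewrite (@precomp_comp _ _ b) // -[RHS](precomp_fold_idem b FF).
  by congr (precomp (precomp b _) _); apply/funext => v; apply: fold_mapE.
rewrite precomp_fold_star //.
rewrite (@eq_symhoms d0 F S (precomp a (fold_map F)) a) ?precomp_fold_idem //.
rewrite (@eq_symhoms d0 F S (precomp (precomp a (fold_map F)) F.1) a) ?flip //.
rewrite (@eq_symhoms d0 F S (precomp (precomp a F.1) (fold_map F)) (precomp a F.1))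
  ?precomp_fold_idem //.
rewrite (@eq_symhoms d0 F S
  (precomp (precomp (precomp a F.1) (fold_map F)) F.1) (precomp a F.1)) ?flip //.
exact: leqif_fiber_product.
Qed.

(* Lovasz's homomorphism counting, rooted at [Fix f] and applied to the halves  *)
(* of [(G, d)]: the maps counted for the target [(G, d)] include [f_L], so some *)
(* map for the other half has the same image and is the identity on [Fix f].    *)
Lemma fold_half_iso F d : F \in Fold G ->
  (forall S psi,
    #|[set al in symhoms d F S d | fix_restrict F al == psi]| =
    #|[set be in symhoms d F S (precomp d F.1) | fix_restrict F be == psi]|) ->
  exists be : {ffun G -> G},
    [/\ be \in symhoms d F setT (precomp d F.1),
        forall v, F.1 v = v -> be v = v
      & be @: setT = fold_map F @: setT].
Proof.
move=> FF eq_half.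
pose fl : {ffun G -> G} := [ffun v => fold_map F v].
have flE : fl = fold_map F :> (G -> G) by apply/funext => v; rewrite ffunE.
pose half a := [set al in symhoms d F setT a | fix_restrict F al == fix_restrict F fl].
have half_eq S : #|[set al in half d | [forall v, al v \in S]]| =
    #|[set be in half (precomp d F.1) | [forall v, be v \in S]]|.
  have sub a : [set al in half a | [forall v, al v \in S]] =
      [set al in symhoms d F S a | fix_restrict F al == fix_restrict F fl].
    have aT (al : {ffun G -> G}) : [forall v, al v \in [set: G]].
      by apply/forallP => v; rewrite inE.
    apply/setP => al; rewrite !inE aT /=.
    by case: [forall v, al v \in S]; rewrite ?andbT ?andbF.
  by rewrite !sub.
have := card_exact_image half_eq (fl @: setT).
have fl_half : fl \in [set al in half d | al @: setT == fl @: setT].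
  rewrite !inE !eqxx !andbT -andbA; apply/and3P; split.
  - by apply/forallP => v; rewrite inE.
  - apply/asboolP; rewrite flE; split=> //; first exact: fold_map_endo.
    by move=> v; rewrite fold_map_V1.
  - by apply/forallP => v; rewrite flE fold_mapE.
move=> eq_card.
have /card_gt0P[be] : 0 < #|[set be in half (precomp d F.1) | be @: setT == fl @: setT]|.
  by rewrite -eq_card; apply/card_gt0P; exists fl.
rewrite !inE => /andP[/andP[be_sym /eqP/fix_restrictP be_fix] /eqP be_im].
exists be; split.
- by rewrite !inE.
- by move=> v fv; rewrite be_fix // flE fold_map_fixed.
- by rewrite be_im; apply: eq_imset => v; rewrite flE.
Qed.

End Homomorphisms.

(** * Reachability and maximal colorings *)

Section Reachability.
Variables (G : bigraph) (FF : {set prefold G}).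
Hypothesis FF_Fold : FF \subset Fold G.
Hypothesis FF_dual : forall F, F \in FF -> dual_fold F \in FF.

Let FF_fold F : F \in FF -> F \in Fold G := subsetP FF_Fold F.

(** The head of the word is the outermost map, matching left-to-right precomposition of
    colorings. *)
Definition word_map (s : seq (prefold G)) : G -> G :=
  foldr (fun F phi => fold_map F \o phi) id s.

Lemma word_map_cat s1 s2 v : word_map (s1 ++ s2) v = word_map s1 (word_map s2 v).
Proof. by elim: s1 => //= F s1 ->. Qed.

Lemma word_map_endo s : {subset s <= FF} -> is_endo (word_map s).
Proof.
elim: s => [|F s IH] sFF u v uv //=; apply: fold_map_endo.
  by apply/FF_fold/sFF; rewrite mem_head.
by apply: IH uv => F' F's; apply: sFF; rewrite inE F's orbT.
Qed.

Lemma word_map_V1 s v : {subset s <= FF} -> (word_map s v \in V1 G) = (v \in V1 G).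
Proof.
elim: s => [|F s IH] sFF //=; rewrite fold_map_V1; last first.
  by apply/FF_fold/sFF; rewrite mem_head.
by apply: IH => F' F's; apply: sFF; rewrite inE F's orbT.
Qed.

Lemma foldl_precomp (D : Type) (d : edge G -> D) s : {subset s <= FF} ->
  foldl (fun a F => precomp a (fold_map F)) d s = precomp d (word_map s).
Proof.
elim: s d => [|F s IH] d sFF /=; first by rewrite precomp_id.
have sFF' : {subset s <= FF} by move=> F' F's; apply: sFF; rewrite inE F's orbT.
rewrite IH // precomp_comp //; last exact: word_map_endo.
by apply/fold_map_endo/FF_fold/sFF; rewrite mem_head.
Qed.

Lemma reachP (D : Type) (d d' : edge G -> D) :
  reach FF d d' <->
  exists2 s, {subset s <= FF} & d' = precomp d (word_map s).
Proof.
split=> [[s sFF ->]|[s sFF ->]]; exists s; rewrite ?foldl_precomp //.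
- move=> F /sFF[FG []//] /FF_dual; by rewrite dual_foldK.
- by move=> F /sFF[FG []//] /FF_dual; rewrite dual_foldK.
by move=> F /sFF FFF; split; [apply: FF_fold|left].
Qed.

Lemma reach_refl (D : Type) (d : edge G -> D) : reach FF d d.
Proof. by exists [::]. Qed.

Lemma reach_step (D : Type) (d d' : edge G -> D) F :
  reach FF d d' -> F \in FF -> reach FF d (precomp d' (fold_map F)).
Proof.
move=> [s sFF ->] FFF; exists (rcons s F); last by rewrite foldl_rcons.
by move=> F'; rewrite mem_rcons inE => /predU1P[->|/sFF//]; split; [apply: FF_fold|left].
Qed.

Lemma reach_ind (D : Type) (P : (edge G -> D) -> Prop) d :
  P d -> (forall a F, F \in FF -> reach FF d a -> P a -> P (precomp a (fold_map F))) ->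
  forall d', reach FF d d' -> P d'.
Proof.
move=> Pd Pstep d' /reachP[s sFF ->]; rewrite -foldl_precomp //.
suff [] : P (foldl (fun a F => precomp a (fold_map F)) d s) /\
  reach FF d (foldl (fun a F => precomp a (fold_map F)) d s) by [].
elim/last_ind: s sFF => [|s F IH] sFF; first by split=> //; apply: reach_refl.
have [|Ps rs] := IH; first by move=> F' F's; apply: sFF; rewrite mem_rcons inE F's orbT.
have FFF : F \in FF by apply: sFF; rewrite mem_rcons mem_head.
by rewrite foldl_rcons; split; [apply: Pstep|apply: reach_step].
Qed.

(** At a reachable coloring with the maximal count N, the bound 2N <= x + y with x, y <= N gives x =
    y = N, so N persists along folds; by maximality [d] is reached from there. *)
Lemma maximal_card_homs (D : Type) (d d0 : edge G -> D) S F :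
  maximal FF d -> F \in FF ->
  #|homs d0 S (precomp d (fold_map F))| = #|homs d0 S d|.
Proof.
move=> d_max FFF; pose attained n :=
  `[< exists2 a, reach FF d a & #|homs d0 S a| = n >].
have att0 : exists n, attained n.
  by exists #|homs d0 S d|; apply/asboolP; exists d => //; apply: reach_refl.
have att_bound n : attained n -> n <= #|{ffun G -> G}|.
  by move=> /asboolP[a _ <-]; apply: max_card.
case: (ex_maxnP att0 att_bound) => N /asboolP[a0 da0 a0N] N_max.
have le_N a : reach FF d a -> #|homs d0 S a| <= N.
  by move=> da; apply: N_max; apply/asboolP; exists a.
have stepN a F' : F' \in FF -> reach FF d a -> #|homs d0 S a| = N ->
    #|homs d0 S (precomp a (fold_map F'))| = N.
  move=> F'FF da aN; have F'G := FF_fold F'FF.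
  have [+ _] := leqif_card_homs d0 S a F'G; rewrite aN mul2n -addnn => le2.
  have := le_N _ (reach_step da F'FF).
  have := le_N _ (reach_step da (FF_dual F'FF)); rewrite fold_map_dual //.
  move=> le_star le_map; apply/eqP; rewrite eqn_leq le_map /=.
  by rewrite -(leq_add2r N); apply: leq_trans le2 _; rewrite leq_add2l.
pose P a := reach FF d a /\ #|homs d0 S a| = N.
suff [dd dN] : P d by rewrite dN; apply: stepN.
apply: (reach_ind (P := P) _ _ (d_max _ da0)) => // a F' F'FF _ [da aN].
by split; [apply: reach_step|apply: stepN].
Qed.

Lemma maximal_fold_iso (D : Type) (d : edge G -> D) F :
  maximal FF d -> F \in FF ->
  exists2 p, isomorphism p d (precomp d (fold_map F)) &
    forall v, fold_map F v = v -> p v = v.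
Proof.
move=> d_max FFF; have FG := FF_fold FFF.
have [S psi|be [/symhomsP[/homsP[_ bE b1 bd] bF] bfix bim]] := @fold_half_iso _ _ F d FG.
  have [_ eq_iff] := leqif_card_homs d S d FG.
  have := eq_iff; rewrite -(fold_map_dual FG) !maximal_card_homs //; last exact: FF_dual.
  by rewrite mul2n -addnn eqxx => /esym/forallP/(_ psi)/eqP.
have fK := fold_involutive FG.
have b_fold v : be (fold_map F v) = be v by rewrite /fold_map; case: ifP.
have fold_b v : fold_map F (be v) = be v.
  have : be v \in fold_map F @: setT by rewrite -bim imset_f.
  by case/imsetP => w _ ->; rewrite fold_map_idem.
(* [be] maps the finite set [fold_map F @: setT] onto itself, hence is injective on it. *)
have b_inj u v : be u = be v -> fold_map F u = fold_map F v.
  have inj : {in fold_map F @: setT &, injective be}.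
    apply/imset_injP; rewrite -[X in _ == #|pred_of_set X|]bim -imset_comp.
    by apply/eqP; congr #|pred_of_set _|; apply: eq_imset => w; apply: b_fold.
  by move=> buv; apply: inj; rewrite ?imset_f // !b_fold.
have fb_out v : F.1 (be v) \notin F.2.
  case: (boolP (be v \in F.2)) => [|bv]; first exact: fold_swap.
  by have := fold_b v; rewrite /fold_map (negPf bv) => ->.
(* [be] takes values in [L] and [Fix f], so following it by [f] sends the other half back outside
   [L]. *)
pose q v := if v \in F.2 then v else F.1 (be v).
have q_inj : injective q.
  move=> u v; rewrite /q; case: ifPn => uL; case: ifPn => vL //.
  - by move=> uE; have := fb_out v; rewrite -uE uL.
  - by move=> vE; have := fb_out u; rewrite vE vL.
  move/perm_inj/b_inj; rewrite /fold_map (negPf uL) (negPf vL); exact: perm_inj.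
have q_fix v : fold_map F v = v -> q v = v.
  by rewrite /q /fold_map; case: ifP => // _ fv; rewrite bfix.
have q_out v : v \notin F.2 -> q v = F.1 (be v) by rewrite /q => /negPf->.
have pE : perm q_inj = q :> (G -> G) by apply/funext => v; rewrite permE.
have q_endo : is_endo q.
  move=> u v uv; have [[fu fv]|[fu fv]] := fold_edge_side FG uv.
    by rewrite !q_fix.
  by rewrite !q_out //; apply: (aut_endo (fold_aut FG)); apply: bE.
exists (perm q_inj); last by move=> v /q_fix; rewrite pE.
split.
  apply: perm_aut; rewrite pE // => v; rewrite /q; case: ifP => // _.
  by rewrite aut_V1 ?fold_aut // b1.
rewrite pE precomp_comp //; last exact: fold_map_endo.
apply/funext => e; have uv : ((val e).1, (val e).2) \in E G.
  by rewrite -surjective_pairing (valP e).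
have [[fu fv]|[fu fv]] := fold_edge_side FG uv; rewrite /precomp.
  by rewrite edge_map_id //= q_fix.
rewrite (@eq_edge_map _ _ be); try by rewrite /= q_out // fold_mapE.
have := congr1 (@^~ e) bd; rewrite -precomp_fold_star // /precomp => ->.
by rewrite edge_map_id // /fold_map_star (negPf fu, negPf fv).
Qed.

(* [p] is the identity on [L] and on [Fix f], so conjugating [f] by [p] changes *)
(* neither the cut nor the side [L], while [d \o f_L = d \o p^-1] makes the     *)
(* conjugate an automorphism of [(G, d)].                                       *)
Lemma fold_iso_reflection (D : Type) (d : edge G -> D) F p :
  F \in Fold G -> isomorphism p d (precomp d (fold_map F)) ->
  (forall v, fold_map F v = v -> p v = v) ->
  exists h, [/\ h \in Aut_col d, Fix h = Fix F.1 & (h, F.2) \in Fold G].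
Proof.
move=> FG [pA pd] p_fix; have fA := fold_aut FG; have fK := fold_involutive FG.
have pL v : v \in F.2 -> p v = v by move=> vL; apply: p_fix; rewrite /fold_map vL.
have fixF v : F.1 v = v -> p v = v by move=> fv; apply/p_fix/fold_map_fixed.
pose h := (p * F.1 * p^-1)%g; exists h.
have hA : h \in Aut_bg G by rewrite !groupM ?groupV.
have pV v : p v = v -> (p^-1)%g v = v by move=> {1}<-; rewrite permK.
have hFix : Fix h = Fix F.1.
  apply/setP => v; rewrite !inE !permM; apply/eqP/eqP => [hv|fv]; last first.
    by rewrite (fixF _ fv) fv (pV _ (fixF _ fv)).
  have fpv : F.1 (p v) = p v by rewrite -[in RHS]hv permKV.
  by have /perm_inj pv := fixF _ fpv; rewrite pv in fpv.
have himL : h @: F.2 = F.1 @: F.2.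
  have pfL : p @: (F.1 @: F.2) = F.1 @: F.2.
    apply/eqP; rewrite eqEcard [#|p @: _|]card_imset ?leqnn ?andbT; last exact: perm_inj.
    apply/subsetP => _ /imsetP[_ /imsetP[v vL ->] ->].
    rewrite -(fK (p _)) imset_f //; apply: contraT => fpL.
    case: (boolP (p (F.1 v) \in F.2)) => pfL.
      by have := fold_swap FG vL; rewrite -(perm_inj (pL _ pfL)) pfL.
    have fp := fold_opposite FG pfL fpL; have /perm_inj pv := fixF _ fp.
    rewrite pv in fp; have := fold_moved FG vL.
    by rewrite -{2}(fK v) fp eqxx.
  have -> : h @: F.2 = (p^-1)%g @: (F.1 @: F.2).
    rewrite -imset_comp; apply: eq_in_imset => v vL.
    by rewrite /= !permM pL.
  rewrite -[in LHS]pfL -imset_comp -[RHS]imset_id; apply: eq_imset => v.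
  by rewrite /= permK.
have hK v : h (h v) = v by rewrite !permM permKV fK permK.
split=> //; last first.
  move: FG; case: (F) hFix himL fK => f L /= hFix himL fK.
  rewrite !inE /cut_involution hFix himL hA /= => /andP[/and3P[_ _ ->] ->].
  by rewrite !andbT; apply/forallP => v; rewrite hK.
rewrite inE; apply/asboolP; split=> //.
have pE := aut_endo pA; have fE := fold_map_endo FG.
have pVE : is_endo (p^-1)%g by apply: aut_endo; rewrite groupV.
have dpV : precomp d (p^-1)%g = precomp d (fold_map F).
  rewrite -[in LHS]pd precomp_comp //; rewrite -[RHS]/(precomp _ (fold_map F)).
  by rewrite -[LHS]/(precomp _ _) precomp_id // => v; rewrite /= permKV.
have -> : precomp d h = precomp (precomp (precomp d (p^-1)%g) F.1) p.
  rewrite !precomp_comp //; try exact: aut_endo.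
    by congr precomp; apply/funext => v; rewrite !permM.
  by move=> u v uv; apply: (aut_endo fA); apply: pE.
rewrite dpV (@precomp_comp _ _ d) //; last exact: aut_endo.
by rewrite -[RHS]pd; congr (precomp (precomp d _) _); apply/funext => v; apply: fold_mapE.
Qed.

End Reachability.

(** * Left-colorings and words of minimal rank *)

Lemma perm_of_imset (T : finType) (f : T -> T) (I : {set T}) : f @: I = I ->
  exists q : {perm T}, forall x, q x = if x \in I then f x else x.
Proof.
move=> fI; have fII x : x \in I -> f x \in I by move=> xI; rewrite -fI imset_f.
have f_inj : {in I &, injective f} by apply/imset_injP; rewrite fI.
pose g x := if x \in I then f x else x.
have g_inj : injective g.
  move=> x y; rewrite /g; case: ifPn => xI; case: ifPn => yI //; first exact: f_inj.
    by move=> xy; rewrite -xy fII in yI.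
  by move=> xy; rewrite xy fII in xI.
by exists (perm g_inj) => x; rewrite permE.
Qed.

(** Written with [m.+1] so that [m] further iterations undo one application of [f] on [I]. *)
Lemma iter_id_of_imset (T : finType) (f : T -> T) (I : {set T}) :
  f @: I = I -> exists m, forall x, x \in I -> iter m.+1 f x = x.
Proof.
move=> fI; have fII x : x \in I -> f x \in I by move=> xI; rewrite -fI imset_f.
have [q qE] := perm_of_imset fI.
have qn n x : x \in I -> iter n q x = iter n f x /\ iter n f x \in I.
  move=> xI; elim: n => //= n [-> nI]; split; last exact: fII.
  by rewrite qE nI.
exists #[q]%g.-1 => x xI; rewrite prednK ?order_gt0 //.
by rewrite -(qn _ _ xI).1 -permX expg_order perm1.
Qed.

Section LeftColorings.
Variables (G : bigraph) (C C' : Type) (c : edge G -> C').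
Implicit Types (l : lvertex G -> C).

(* The default value is irrelevant for maps that preserve [V1 G].               *)
Definition lmap (phi : G -> G) (u : lvertex G) : lvertex G := insubd u (phi (val u)).

Lemma val_lmap (phi : G -> G) u :
  (forall v, (phi v \in V1 G) = (v \in V1 G)) -> val (lmap phi u) = phi (val u).
Proof. by move=> p1; rewrite val_insubd p1 (valP u). Qed.

Lemma precomp_tensor l phi :
  is_endo phi -> (forall v, (phi v \in V1 G) = (v \in V1 G)) ->
  precomp (tensor l c) phi = tensor (l \o lmap phi) (precomp c phi).
Proof.
move=> pE p1; apply/funext => e; congr (l _, _); apply: val_inj.
by rewrite val_lmap //= val_edge_map.
Qed.

Lemma precomp_tensor_aut l g : g \in Aut_col c ->
  precomp (tensor l c) g = tensor (l \o lmap g) c.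
Proof.
rewrite inE => /asboolP[gA gc]; rewrite precomp_tensor ?gc //; first exact: aut_endo.
by move=> v; rewrite aut_V1.
Qed.

Lemma tensor_snd l l' (c' : edge G -> C') : tensor l c = tensor l' c' -> c = c'.
Proof. by move=> eqt; apply/funext => e; have := congr1 (fun d => (d e).2) eqt. Qed.

Hypothesis G_connected : connected G.

(** Needed because [tensor l c] sees [l] only at endpoints of edges. A path from [u] to another
    vertex starts with an edge at [u]. *)
Lemma lvertex_has_edge (u v : lvertex G) : u <> v -> exists e, lend e = u.
Proof.
move=> uv; have /forall_inP/(_ (val u)) := G_connected; rewrite !inE => /(_ isT).
move/forall_inP/(_ (val v)); rewrite !inE => /(_ isT)/connectP[[|x p]] /=.
  by move=> _ /val_inj/esym.
move=> /andP[/and3P[_ _ /orP[ux|xu]] _ _].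
  by exists (exist _ (val u, x) ux); apply: val_inj.
have /subsetP/(_ _ xu)/setXP[_ /=] := @E_sub G.
by rewrite V2_setC inE (valP u).
Qed.

Lemma mono_tensor_monochromatic l : mono_tensors C c (tensor l c) -> monochromatic l.
Proof.
move=> [m m_mono lm] u v; have [->//|uv] := pselect (u = v).
have [e eu] := lvertex_has_edge uv.
have [e' ev] := lvertex_has_edge (fun vu : v = u => uv (esym vu)).
have := congr1 (fun d => (d e).1) lm; have := congr1 (fun d => (d e').1) lm.
by rewrite /tensor /= eu ev => -> ->.
Qed.

Variable FF : {set prefold G}.
Hypothesis FF_sub : FF \subset Fold_col c.
Hypothesis FF_inv : invariant_folds (Aut_col c)%G FF.

Lemma invariant_folds_Fold : FF \subset Fold G.
Proof. by apply: fintype.subset_trans FF_sub _; apply/subsetP => F; rewrite inE => /andP[]. Qed.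
Let FF_Fold := invariant_folds_Fold.
Let FF_fold F : F \in FF -> F \in Fold G := subsetP FF_Fold F.

Lemma fold_Aut_col F : F \in FF -> F.1 \in Aut_col c.
Proof. by move/(subsetP FF_sub); rewrite inE => /andP[]. Qed.

(** Conjugating [(f, L)] by [f] itself yields the dual fold. *)
Lemma invariant_folds_dual F : F \in FF -> dual_fold F \in FF.
Proof.
by move=> FFF; have := FF_inv (fold_Aut_col FFF) FFF; rewrite mulVg mul1g.
Qed.
Let FF_dual := invariant_folds_dual.

Lemma precomp_fold_col F : F \in FF -> precomp c (fold_map F) = c.
Proof.
move=> FFF; have := fold_Aut_col FFF; rewrite inE => /asboolP[_ cf].
apply/funext => e; have uv : ((val e).1, (val e).2) \in E G.
  by rewrite -surjective_pairing (valP e).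
have [[fu fv]|[fu fv]] := fold_edge_side (FF_fold FFF) uv; rewrite /precomp.
  by rewrite edge_map_id.
rewrite -[RHS](congr1 (@^~ e) cf) /precomp; congr c.
by apply: eq_edge_map; rewrite /fold_map (negPf fu, negPf fv).
Qed.

Lemma precomp_word_col s : {subset s <= FF} -> precomp c (word_map s) = c.
Proof.
move=> sFF; rewrite -(foldl_precomp FF_Fold) //.
elim: s sFF => //= F s IH sFF; rewrite precomp_fold_col ?sFF ?mem_head //.
by apply: IH => F' F's; apply: sFF; rewrite inE F's orbT.
Qed.

Lemma precomp_tensor_word l s : {subset s <= FF} ->
  precomp (tensor l c) (word_map s) = tensor (l \o lmap (word_map s)) c.
Proof.
move=> sFF; rewrite precomp_tensor ?precomp_word_col //.
  exact: word_map_endo sFF.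
by move=> v; apply: word_map_V1 sFF.
Qed.

Lemma tensor_reachP l d : reach FF (tensor l c) d <->
  exists2 s, {subset s <= FF} & d = tensor (l \o lmap (word_map s)) c.
Proof.
split=> [/(reachP FF_Fold FF_dual)[s sFF ->]|[s sFF ->]].
  by exists s; rewrite ?precomp_tensor_word.
by apply/(reachP FF_Fold FF_dual); exists s; rewrite ?precomp_tensor_word.
Qed.

(** * Collapsing words and fold-stable colorings *)

Definition collapsing s := {subset s <= FF} /\
  exists2 v0, v0 \in V1 G & forall v, v \in V1 G -> word_map s v = v0.

Lemma collapsing_mono l s : collapsing s -> monochromatic (l \o lmap (word_map s)).
Proof.
move=> [sFF [v0 _ s0]] u v /=; congr l; apply: val_inj.
by rewrite !val_lmap ?s0 ?(valP u) ?(valP v) // => w; apply: word_map_V1 sFF.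
Qed.

Lemma collapsing_reach l s : collapsing s ->
  reach_set FF (tensor l c) (mono_tensors C c).
Proof.
move=> cs; exists (tensor (l \o lmap (word_map s)) c).
  by exists (l \o lmap (word_map s)) => //; apply: collapsing_mono.
by apply/tensor_reachP; exists s => //; case: cs.
Qed.

Lemma rainbow_reach_collapsing (r : lvertex G -> C) :
  V1 G != set0 -> rainbow r -> reach_set FF (tensor r c) (mono_tensors C c) ->
  exists s, collapsing s.
Proof.
move=> /set0Pn[x xV] r_inj [d [m m_mono ->]] /tensor_reachP[s sFF mE].
exists s; split=> //; exists (word_map s x); first by rewrite (word_map_V1 FF_Fold).
move=> v vV; have mono : monochromatic (r \o lmap (word_map s)).
  by apply: mono_tensor_monochromatic; rewrite -mE; exists m.
have /r_inj/(congr1 val) := mono (exist _ v vV) (exist _ x xV).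
by rewrite !val_lmap // => w; apply: word_map_V1 sFF.
Qed.

(** The sets of a percolating sequence are the preimages of one vertex under the prefixes of a
    word. *)
Lemma left_cut_percolatingP : left_cut_percolating FF <-> exists s, collapsing s.
Proof.
split=> [[n [W [W_sub W0 Wn W_step]]]|[s [sFF [v0 v0V s0]]]].
  have /cards1P[v0 W0E] : #|W 0| == 1 by rewrite W0.
  have pre i : i <= n -> exists2 s, {subset s <= FF} &
      forall v, (v \in W i) = (word_map s v == v0).
    elim: i => [|i IH] i_n; first by exists [::] => // v; rewrite W0E inE.
    have [s sFF sW] := IH (ltnW i_n); have [F FFF WE] := W_step i i_n.
    exists (rcons s F) => [F'|v].
      by rewrite mem_rcons inE => /predU1P[->|/sFF].
    by rewrite WE inE sW -cats1 word_map_cat.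
  have [s sFF sW] := pre n (leqnn n); exists s; split=> //; exists v0.
    by apply: (subsetP (W_sub 0 isT)); rewrite W0E inE.
  by move=> v; rewrite -Wn sW => /eqP.
pose F0 : prefold G := (1%g, set0).
have takeFF i : {subset take i s <= FF} by move=> F /mem_take/sFF.
exists (size s), (fun i => word_map (take i s) @^-1: [set v0]); split.
- move=> i _; apply/subsetP => v; rewrite !inE => /eqP vE.
  by rewrite -(word_map_V1 FF_Fold _ (takeFF i)) vE.
- by rewrite take0 -(cards1 v0); apply: eq_card => v; rewrite !inE.
- apply/setP => v; rewrite take_size !inE; apply/eqP/idP => [vE|/s0//].
  by rewrite -(word_map_V1 FF_Fold _ sFF) vE.
move=> i i_s; exists (nth F0 s i); first by apply/sFF/mem_nth.
apply/setP => v; rewrite !inE (take_nth F0) // -cats1 word_map_cat //.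
Qed.

(** If [F'] is the conjugate of [F] by [k], then [d \o k \o f_L = d \o f'_L' \o k], and stability at
    [F'] replaces [f'_L'] by [g^-1]. *)
Lemma fold_stable_reach (D : Type) (d d' : edge G -> D) :
  fold_stable (Aut_col c)%G FF d -> reach FF d d' ->
  exists2 k, k \in Aut_col c & d' = precomp d k.
Proof.
move=> d_st dd'; pose P a := exists2 k, k \in Aut_col c & a = precomp d k.
apply: (reach_ind FF_Fold FF_dual (P := P) _ _ dd').
  by exists 1%g; [exact: group1|rewrite precomp_id // => v; rewrite perm1].
have endoK k : k \in Aut_col c -> is_endo k.
  by rewrite inE => /asboolP[kA _]; apply: aut_endo.
move=> _ F FFF _ [k kK ->]; have F'FF := FF_inv kK FFF.
set F' := (_, _) in F'FF; have [g gK [_ gd]] := d_st _ F'FF.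
have kE := endoK _ kK; have gE := endoK _ gK.
have F'E := fold_map_endo (FF_fold F'FF); have FE := fold_map_endo (FF_fold FFF).
have gVK : (g^-1)%g \in Aut_col c by rewrite groupV.
exists (k * g^-1)%g; first by rewrite groupM.
have dF' : precomp d (fold_map F') = precomp d (g^-1)%g.
  rewrite -[in RHS]gd precomp_comp //; last exact: endoK.
  by rewrite [RHS]precomp_id // => v; rewrite /= permKV.
have -> : precomp d (k * g^-1)%g = precomp (precomp d (g^-1)%g) k.
  rewrite precomp_comp //; last exact: endoK.
  by congr precomp; apply/funext => v; rewrite permM.
rewrite -dF' !precomp_comp //; congr precomp; apply/funext => v /=.
by rewrite fold_map_conj permK.
Qed.

Lemma fold_stable_monochromatic l s : collapsing s ->
  fold_stable (Aut_col c)%G FF (tensor l c) -> monochromatic l.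
Proof.
move=> cs l_st; have [sFF _] := cs.
have /(fold_stable_reach l_st)[k kK] :
    reach FF (tensor l c) (tensor (l \o lmap (word_map s)) c).
  by apply/tensor_reachP; exists s.
rewrite precomp_tensor_aut // => sk.
have k_mono : monochromatic (l \o lmap k).
  apply: mono_tensor_monochromatic; rewrite -sk.
  by exists (l \o lmap (word_map s)) => //; apply: collapsing_mono.
have kV (g : {perm G}) : g \in Aut_col c -> forall v, (g v \in V1 G) = (v \in V1 G).
  by rewrite inE => /asboolP[gA _] v; apply: aut_V1.
have kVK : (k^-1)%g \in Aut_col c by rewrite groupV.
have onto u : u = lmap k (lmap (k^-1)%g u).
  by apply: val_inj; rewrite !val_lmap ?permKV //; apply: kV.
by move=> u v; rewrite (onto u) (onto v); apply: k_mono.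
Qed.

(** At a single vertex each fold acts as the identity or as its involution; [k] depends on [v]. *)
Lemma word_map_fold_group s v : {subset s <= FF} ->
  exists2 k, k \in fold_group FF & word_map s v = k v.
Proof.
elim: s => [|F s IH] sFF; first by exists 1%g; rewrite ?group1 ?perm1.
have [|k kK sv] := IH; first by move=> F' F's; apply: sFF; rewrite inE F's orbT.
rewrite /= sv /fold_map; case: ifP => _; first by exists k.
exists (k * F.1)%g; last by rewrite permM.
by rewrite groupM // mem_gen // imset_f // sFF // mem_head.
Qed.

Lemma collapsing_transitive s :
  collapsing s -> left_vertex_transitive (fold_group FF).
Proof.
move=> [sFF [v0 _ s0]] u v uV vV.
have [k kK ku] := word_map_fold_group u sFF; rewrite s0 // in ku.
have [k' k'K kv] := word_map_fold_group v sFF; rewrite s0 // in kv.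
by exists (k * k'^-1)%g; rewrite ?groupM ?groupV // permM -ku kv permK.
Qed.

Lemma maximal_strongly_fold_stable l : maximal FF (tensor l c) ->
  strongly_fold_stable (Fold G) (Aut_col c)%G FF (tensor l c).
Proof.
move=> l_max; split=> F FFF; have [p p_iso p_fix] :=
  maximal_fold_iso FF_Fold FF_dual l_max FFF; last first.
  exact: (fold_iso_reflection (FF_fold FFF) p_iso p_fix).
exists p => //; have [pA pl] := p_iso; rewrite inE; apply/asboolP; split=> //.
have FE := fold_map_endo (FF_fold FFF).
have F1 v := fold_map_V1 v (FF_fold FFF).
have pE := aut_endo pA; move: pl; rewrite precomp_tensor // precomp_fold_col //.
rewrite precomp_tensor // => [/esym/tensor_snd/esym//|v]; exact: aut_V1.
Qed.

(** * Words of minimal rank *)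

Definition word_rank s := #|word_map s @: V1 G|.

Definition min_word e := {subset e <= FF} /\
  forall s, {subset s <= FF} -> word_rank e <= word_rank s.

Lemma cat_sub s1 s2 : {subset s1 <= FF} -> {subset s2 <= FF} ->
  {subset s1 ++ s2 <= FF}.
Proof. by move=> s1F s2F F; rewrite mem_cat => /orP[/s1F|/s2F]. Qed.

(** The word [e s e] has its image inside that of [e], and minimality forbids a smaller one. *)
Lemma min_word_imset e s : min_word e -> {subset s <= FF} ->
  word_map (e ++ s) @: (word_map e @: V1 G) = word_map e @: V1 G.
Proof.
move=> [eF e_min] sF; apply/eqP; rewrite eqEcard; apply/andP; split.
  apply/subsetP => _ /imsetP[_ /imsetP[v vV ->] ->].
  by rewrite word_map_cat imset_f // !(word_map_V1 FF_Fold).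
rewrite -imset_comp.
have -> : (word_map (e ++ s) \o word_map e) @: V1 G = word_map ((e ++ s) ++ e) @: V1 G.
  by apply: eq_imset => v; rewrite [RHS]word_map_cat.
by apply: e_min; apply: cat_sub => //; apply: cat_sub.
Qed.

Lemma iter_word_map m s (v : G) : word_map (flatten (nseq m s)) v = iter m (word_map s) v.
Proof. by elim: m => //= m IH; rewrite word_map_cat IH. Qed.

Lemma flatten_nseq_sub m s : {subset s <= FF} -> {subset flatten (nseq m s) <= FF}.
Proof. by move=> sF; elim: m => //= m IH; apply: cat_sub. Qed.

(** Since [e s] permutes the image of [e], some power satisfies [(e s)^(m+1) e = e] on [V1 G]; hence
    [(e s)^m e] undoes [s]. *)
Lemma min_word_maximal e l : min_word e ->
  maximal FF (tensor (l \o lmap (word_map e)) c).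
Proof.
move=> e_min d /tensor_reachP[s sF ->]; have [eF _] := e_min.
have [m mE] := iter_id_of_imset (min_word_imset e_min sF).
pose t := flatten (nseq m (e ++ s)) ++ e.
have tF : {subset t <= FF}.
  by apply: cat_sub => //; apply: flatten_nseq_sub; apply: cat_sub.
apply/tensor_reachP; exists t => //; congr tensor; apply/funext => u /=.
have V1w w : {subset w <= FF} -> forall v, (word_map w v \in V1 G) = (v \in V1 G).
  by move=> wF v; apply: word_map_V1 wF.
congr l; apply: val_inj; rewrite !(val_lmap _ (V1w _ _)) //.
rewrite -!word_map_cat catA word_map_cat [RHS]word_map_cat iter_word_map.
by rewrite -iterS mE // imset_f // (valP u).
Qed.

Lemma exists_idempotent_min_word : exists2 e, min_word e &
  forall v, v \in V1 G -> word_map e (word_map e v) = word_map e v.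
Proof.
have [s0 s0_min] : exists s, min_word s.
  pose attained n := `[< exists2 s, {subset s <= FF} & word_rank s = n >].
  have att0 : exists n, attained n.
    by exists (word_rank [::]); apply/asboolP; exists [::].
  case: (ex_minnP att0) => _ /asboolP[s sF <-] s_min; exists s; split=> // s' s'F.
  by apply: s_min; apply/asboolP; exists s'.
have nilF : {subset [::] <= FF} by [].
have := min_word_imset s0_min nilF; rewrite cats0 => /iter_id_of_imset[m mE].
have [s0F s0_le] := s0_min; exists (flatten (nseq m.+1 s0)).
  split=> [|s sF]; first exact: flatten_nseq_sub.
  apply: leq_trans (s0_le s sF); apply/subset_leq_card/subsetP => _ /imsetP[v vV ->].
  by rewrite iter_word_map iterS imset_f // -iter_word_map (word_map_V1 FF_Fold) //;
    apply: flatten_nseq_sub.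
move=> v vV; rewrite !iter_word_map mE // iterS imset_f //.
by rewrite -iter_word_map (word_map_V1 FF_Fold) //; apply: flatten_nseq_sub.
Qed.

(** The map of colors induced through [r] by a map of left vertices; colors outside the range of [r]
    stay fixed. *)
Definition relabel (r : lvertex G -> C) (phi : G -> G) (x : C) : C :=
  if pselect (exists u, r u = x) is left ux then r (lmap phi (projT1 (cid ux)))
  else x.

Lemma relabel_rainbow r phi u : rainbow r -> relabel r phi (r u) = r (lmap phi u).
Proof.
move=> r_inj; rewrite /relabel; case: pselect => [ux|[]]; last by exists u.
by congr (r (lmap _ _)); apply: r_inj; apply: (projT2 (cid ux)).
Qed.

Lemma relabelK r (q : {perm G}) : rainbow r ->
  (forall v, (q v \in V1 G) = (v \in V1 G)) ->
  cancel (relabel r q) (relabel r (q^-1)%g).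
Proof.
move=> r_inj q1 x; have qV1 v : ((q^-1)%g v \in V1 G) = (v \in V1 G).
  by rewrite -q1 permKV.
have [[u <-]|xr] := pselect (exists u, r u = x).
  rewrite !relabel_rainbow //; congr r; apply: val_inj.
  by rewrite !val_lmap // permK.
have xE phi : relabel r phi x = x by rewrite /relabel; case: pselect.
by rewrite !xE.
Qed.

Lemma relabel_bij r (q : {perm G}) : rainbow r ->
  (forall v, (q v \in V1 G) = (v \in V1 G)) -> bijective (relabel r q).
Proof.
move=> r_inj q1; exists (relabel r (q^-1)%g); first exact: relabelK.
by rewrite -{2}(invgK q); apply: relabelK => // v; rewrite -q1 permKV.
Qed.

Definition conj_fold (h : {perm G}) (F : prefold G) : prefold G :=
  ((h^-1 * F.1 * h)%g, h @: F.2).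

Lemma word_map_conj h s v :
  word_map (map (conj_fold h) s) v = h (word_map s (h^-1%g v)).
Proof.
elim: s => [|F s IH] /=; first by rewrite permKV.
by rewrite fold_map_conj IH permK.
Qed.

(* With [e] idempotent of minimal rank and [k (e u) = e v], the word            *)
(* [e k e k^-1] again has minimal rank, so [e k] permutes the image of [e] and  *)
(* maps [e u] to [e v]; fold-stability turns [e k e k^-1] into [e g].           *)
Lemma min_word_left_symmetric (r : lvertex G -> C) e : rainbow r -> min_word e ->
  (forall v, v \in V1 G -> word_map e (word_map e v) = word_map e v) ->
  left_vertex_transitive (Aut_col c)%G ->
  left_symmetrically_fold_stable (Fold G) (Aut_col c)%G FF
    (r \o lmap (word_map e)) c.
Proof.
move=> r_inj e_min e_idem trans; have [eF e_le] := e_min.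
have l_stable := maximal_strongly_fold_stable (@min_word_maximal e r e_min).
split=> // _ _ [u _ <-] [v _ <-]; have [l_fold _] := l_stable.
set we := word_map e in e_idem l_fold *; set l := r \o lmap we in l_fold *.
have we1 w : (we w \in V1 G) = (w \in V1 G) by apply: word_map_V1 eF.
have [||k kK kuv] := trans (we (val u)) (we (val v)); rewrite ?we1 ?(valP u) ?(valP v) //.
have kA : k \in Aut_bg G by move: kK; rewrite inE => /asboolP[].
have k1 w : (k w \in V1 G) = (w \in V1 G) by apply: aut_V1.
have kV1 w : ((k^-1)%g w \in V1 G) = (w \in V1 G) by rewrite -k1 permKV.
pose e' := map (conj_fold k) e.
have e'F : {subset e' <= FF} by move=> _ /mapP[F /eF FFF ->]; apply: FF_inv.
pose I := we @: V1 G.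
have ekI : (we \o k) @: I = I.
  apply/eqP; rewrite eqEcard; apply/andP; split.
    apply/subsetP => _ /imsetP[_ /imsetP[w wV ->] ->].
    by rewrite /= imset_f // k1 we1.
  have -> : (we \o k) @: I = word_map (e ++ e') @: V1 G.
    rewrite -imset_comp; apply/setP => x; apply/imsetP/imsetP => [[w wV ->]|[w wV ->]].
      by exists (k w); rewrite ?k1 // word_map_cat word_map_conj permK.
    by exists ((k^-1)%g w); rewrite ?kV1 // word_map_cat word_map_conj.
  by apply: e_le; apply: cat_sub.
have [q qE] := perm_of_imset ekI.
have q1 w : (q w \in V1 G) = (w \in V1 G) by rewrite qE; case: ifP; rewrite //= we1 k1.
have [|g gK gE] := @fold_stable_reach _ _ (tensor (l \o lmap (word_map e')) c) l_fold.
  by apply/tensor_reachP; exists e'.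
(* With [sigma = relabel r q], both [sigma \o l] moved by [k^-1] and [l] moved by [g] equal [l]
   precomposed with the word [e']. *)
exists (g^-1 * k^-1)%g, (relabel r q); split.
- by rewrite groupM ?groupV.
- exact: relabel_bij.
- rewrite /l /= relabel_rainbow //; congr r; apply: val_inj.
  by rewrite !val_lmap // qE imset_f ?(valP u) //= kuv e_idem // (valP v).
have gA : g \in Aut_bg G by move: gK; rewrite inE => /asboolP[].
have gV : (g^-1)%g \in Aut_bg G by rewrite groupV.
have kV : (k^-1)%g \in Aut_bg G by rewrite groupV.
split; first by rewrite groupM.
have -> : precomp (tensor (relabel r q \o l) c) (g^-1 * k^-1)%g =
    precomp (precomp (tensor (relabel r q \o l) c) (k^-1)%g) (g^-1)%g.
  rewrite precomp_comp; [|exact: aut_endo..].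
  by congr precomp; apply/funext => w; rewrite permM.
rewrite precomp_tensor_aut ?groupV //.
have -> : (relabel r q \o l) \o lmap (k^-1)%g = l \o lmap (word_map e').
  apply/funext => w; rewrite /l /= relabel_rainbow //; congr r; apply: val_inj.
  have we'1 x : (word_map e' x \in V1 G) = (x \in V1 G) by apply: word_map_V1 e'F.
  by rewrite !val_lmap // qE imset_f ?kV1 ?(valP w) //= word_map_conj.
rewrite gE precomp_comp; [|exact: aut_endo..].
by rewrite precomp_id // => w; rewrite /= permKV.
Qed.

End LeftColorings.

(** * Percolation *)

Section Percolation.
Variables (R : realType) (G : bigraph) (D : Type) (FF : {set prefold G}).
Variable CC : set (edge G -> D).
Hypothesis FF_Fold : FF \subset Fold G.
Hypothesis FF_dual : forall F, F \in FF -> dual_fold F \in FF.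
Implicit Types (d : edge G -> D) (s t : seq bool) (T : {fset (seq bool)}).

Let FF_fold F : F \in FF -> F \in Fold G := subsetP FF_Fold F.

Lemma tree_upP T s :
  reflect (s = [::] \/ exists t i, t \in T /\ s = rcons t i) (s \in tree_up T).
Proof.
rewrite in_fsetU in_fset1; apply: (iffP orP) => [[/eqP|/imfset2P]|[->|]]; first by left.
- by move=> [t tT [i _ ->]]; right; exists t, i.
- by left.
move=> [t [i [tT ->]]]; right; apply/imfset2P; exists t => //; exists i => //.
by apply/fset2P; case: i; [right|left].
Qed.

Lemma mem_leaves T s : (s \in leaves T) =
  (s \in T) && all (fun t => prefix s t ==> (t == s)) T.
Proof. by rewrite in_fset /= inE. Qed.

Lemma tree_reach T phi d s : binary_tree T -> (forall t, t \in T -> phi t \in FF) ->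
  s \in tree_up T -> reach FF d (tree_col phi d s).
Proof.
move=> T_tree phiF; elim/last_ind: s => [|s i IH] sT; first exact: reach_refl.
have {sT}sT : s \in T.
  case/tree_upP: sT => [/(congr1 size)|[t [j [tT /rcons_inj[-> _]]]]] //.
  by rewrite size_rcons.
rewrite tree_col_rcons.
have rs : reach FF d (tree_col phi d s).
  apply: IH; apply/tree_upP; case/lastP: s sT => [|s j] sT; [by left|right].
  by exists s, j; split=> //; apply: T_tree sT; rewrite -cats1 prefix_prefix.
case: i => /=; last by apply: (reach_step FF_Fold) => //; apply: phiF.
rewrite -fold_map_dual; last exact/FF_fold/phiF.
by apply: (reach_step FF_Fold) => //; apply/FF_dual/phiF.
Qed.

(** A mass tending to 1 is eventually nonzero, so some leaf lies in [CC], and leaves are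
    reachable. *)
Lemma percolates_reach d : percolates_to R FF d CC -> reach_set FF d CC.
Proof.
move=> [T [phi [T_tree _ phiF _ mu_cvg]]].
have [N _ muN] := cvgr_neq0 _ mu_cvg (oner_neq0 R).
have {muN}mu_neq0 := muN N (leqnn N).
have [[s [sL sCC]]|no_leaf] :=
    pselect (exists s, s \in leaves (tree_up (T N)) /\ CC (tree_col (phi N) d s)).
  exists (tree_col (phi N) d s) => //; apply: (tree_reach _ (T_tree N) (phiF N)).
  by move: sL; rewrite mem_leaves => /andP[].
case/eqP: mu_neq0; rewrite /mu big_seq_cond big1 // => s /andP[sL /asboolP sCC].
by case: no_leaf; exists s.
Qed.

(** * Mass along complete binary trees *)

Fixpoint bitwords n : seq (seq bool) :=
  if n is n'.+1 then
    map (cons false) (bitwords n') ++ map (cons true) (bitwords n')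
  else [:: [::]].

Lemma mem_bitwords n s : (s \in bitwords n) = (size s == n).
Proof.
elim: n s => [|n IH] s /=; first by rewrite inE size_eq0.
rewrite mem_cat; case: s => [|i s].
  by apply/negP => /orP[] /mapP[].
rewrite eqSS -IH; apply/orP/idP => [[] /mapP[t tn [_ ->]] //|sn].
by case: i; [right|left]; apply/mapP; exists s.
Qed.

Lemma bitwords_uniq n : uniq (bitwords n).
Proof.
elim: n => //= n IH; rewrite cat_uniq !map_inj_uniq ?IH /=; try by move=> s t [].
by rewrite andbT; apply/hasPn => _ /mapP[s _ ->]; apply/negP => /mapP[].
Qed.

Definition full_tree n : {fset (seq bool)} :=
  [fset s | s in flatten (map bitwords (iota 0 n))]%fset.

Lemma mem_full_tree n s : (s \in full_tree n) = (size s < n).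
Proof.
rewrite in_fset /=; apply/flatten_mapP/idP => [[i]|s_n].
  by rewrite mem_iota mem_bitwords => /andP[_ i_n] /eqP->.
by exists (size s); rewrite ?mem_iota ?mem_bitwords.
Qed.

Lemma mem_tree_up_full n s : (s \in tree_up (full_tree n)) = (size s <= n).
Proof.
apply/tree_upP/idP => [[->//|[t [i [+ ->]]]]|].
  by rewrite mem_full_tree size_rcons.
case/lastP: s => [|s i]; [by left|rewrite size_rcons => s_n; right].
by exists s, i; rewrite mem_full_tree.
Qed.

Lemma leaves_full_tree n :
  perm_eq (leaves (tree_up (full_tree n))) (bitwords n).
Proof.
apply: uniq_perm; rewrite ?fset_uniq ?bitwords_uniq // => s.
rewrite mem_bitwords mem_leaves mem_tree_up_full eqn_leq; apply/andP/andP => -[s_n].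
  move/allP => s_max; split=> //; rewrite leqNgt; apply/negP => s_lt.
  have /s_max : rcons s false \in tree_up (full_tree n).
    by rewrite mem_tree_up_full size_rcons.
  rewrite -cats1 prefix_prefix /= => /eqP/(congr1 size).
  by rewrite size_cat addn1 => /eqP; rewrite eqn_leq ltnn.
move=> n_s; split=> //; apply/allP => t; rewrite mem_tree_up_full => t_n.
apply/implyP => /prefixP[t' tE]; move: t_n; rewrite tE size_cat.
case: t' {tE} => [|i t']; first by rewrite cats0.
by rewrite leqNgt (leq_ltn_trans n_s) // addnS ltnS leq_addr.
Qed.

Local Open Scope ring_scope.

(** The probability that a random descent misses [CC] when all nodes of a level carry the same fold,
    listed in [ws]. *)
Fixpoint bad_mass (ws : seq (prefold G)) d : R :=
  if ws is F :: ws' then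
    2%:R^-1 * (bad_mass ws' (precomp d (fold_map F)) +
               bad_mass ws' (precomp d (fold_map_star F)))
  else if `[< CC d >] then 0 else 1.

(** The starting node [s0] is arbitrary so that the induction applies to both subtrees. *)
Lemma mass_bitwords (f : nat -> prefold G) n s0 d :
  \sum_(s <- bitwords n | `[< CC (tree_col_from (fun t => f (size t)) s0 d s) >])
     2%:R ^- size s = 1 - bad_mass (map f (iota (size s0) n)) d :> R.
Proof.
elim: n s0 d => [|n IH] s0 d /=.
  by rewrite big_mkcond big_seq1 /=; case: asboolP => _; rewrite ?expr0 ?invr1 ?subr0 ?subrr.
rewrite big_cat !big_map /=.
have half i : \sum_(s <- bitwords n | `[< CC (tree_col_from (fun t => f (size t))
      (rcons s0 i) (precomp d (fold_step (f (size s0)) i)) s) >]) 2%:R ^- (size s).+1 =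
    2%:R^-1 * (1 - bad_mass (map f (iota (size s0).+1 n))
                     (precomp d (fold_step (f (size s0)) i))) :> R.
  rewrite -(size_rcons s0 i) -IH big_distrr; apply: eq_bigr => s _.
  by rewrite exprS invfM.
rewrite !half /= -mulrDr; set a := bad_mass _ _; set b := bad_mass _ _.
rewrite addrACA -opprD mulrBr; congr (_ - _).
by rewrite -(mulr2n 1) mulVf // pnatr_eq0.
Qed.

Lemma mu_full_tree (f : nat -> prefold G) n d :
  mu R (full_tree n) (fun t => f (size t)) d CC = 1 - bad_mass (map f (iota 0 n)) d.
Proof. by rewrite /mu (perm_big _ (leaves_full_tree n)); apply: (mass_bitwords f n [::] d). Qed.

Lemma bad_mass_ge0 ws d : 0 <= bad_mass ws d.
Proof.
elim: ws d => [|F ws IH] d /=; first by case: ifP.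
by rewrite mulr_ge0 ?invr_ge0 ?addr_ge0.
Qed.

Lemma bad_mass_le1 ws d : bad_mass ws d <= 1.
Proof.
elim: ws d => [|F ws IH] d /=; first by case: ifP.
by rewrite ler_pdivrMl ?ltr0n // mulr1 lerD.
Qed.

(** The branch that always takes the symbol 1 ends in [CC] and alone has weight [2 ^- size ws]. *)
Lemma bad_mass_collapsing ws d : CC (foldl (fun a F => precomp a (fold_map F)) d ws) ->
  bad_mass ws d <= 1 - 2%:R ^- size ws.
Proof.
elim: ws d => [|F ws IH] d /= dCC; first by rewrite expr0 invr1 subrr asboolT.
rewrite ler_pdivrMl ?ltr0n // mulrBr mulr1 exprS invfM mulrA mulfV ?pnatr_eq0 //.
by rewrite mul1r mulr2n -addrA [leRHS]addrC; apply: lerD; rewrite ?bad_mass_le1 ?IH.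
Qed.

Hypothesis CC_fold : forall d F, F \in FF -> CC d -> CC (precomp d (fold_map F)).

Lemma bad_mass_absorbing ws d : {subset ws <= FF} -> CC d -> bad_mass ws d = 0.
Proof.
elim: ws d => [|F ws IH] d wsF dCC /=; first by rewrite asboolT.
have wsF' : {subset ws <= FF} by move=> F' F's; apply: wsF; rewrite inE F's orbT.
have FFF : F \in FF by apply: wsF; rewrite mem_head.
rewrite -fold_map_dual ?FF_fold // !IH ?addr0 ?mulr0 //; apply: CC_fold => //.
exact: FF_dual.
Qed.

Variable P : set (edge G -> D).
Hypothesis P_fold : forall d F, F \in FF -> P d -> P (precomp d (fold_map F)).

(** Colorings in [CC] after [ws1] stay there; each of the others is still in [P] and misses [CC]
    with probability at most [b]. *)
Lemma bad_mass_cat ws1 ws2 d (b : R) : {subset ws1 <= FF} -> {subset ws2 <= FF} ->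
  0 <= b -> (forall d', P d' -> bad_mass ws2 d' <= b) -> P d ->
  bad_mass (ws1 ++ ws2) d <= b * bad_mass ws1 d.
Proof.
move=> ws1F ws2F b0 ws2b; elim: ws1 ws1F d => [|F ws IH] ws1F d dP /=.
  case: asboolP => dCC; first by rewrite bad_mass_absorbing ?mulr0.
  by rewrite mulr1 ws2b.
have wsF : {subset ws <= FF} by move=> F' F's; apply: ws1F; rewrite inE F's orbT.
have FFF : F \in FF by apply: ws1F; rewrite mem_head.
rewrite mulrCA ler_pM2l ?invr_gt0 ?ltr0n // mulrDr.
by rewrite -fold_map_dual ?FF_fold // lerD // IH //; apply: P_fold => //; apply: FF_dual.
Qed.

(* Descending the complete binary tree, every [size w] levels reach [CC] with   *)
(* probability at least [2 ^- size w].                                          *)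
Lemma collapsing_percolates w d : {subset w <= FF} ->
  (forall d', P d' -> CC (foldl (fun a F => precomp a (fold_map F)) d' w)) -> P d ->
  percolates_to R FF d CC.
Proof.
(* The word repeats periodically down the levels. If it is empty, the trees below are empty and the
   default fold is never read. *)
move=> wF w_coll dP; pose f i := nth (1%g, set0) w (i %% size w).
have f_period k : map f (iota 0 (k * size w)) = flatten (nseq k w).
  elim: k => //= k IH; rewrite mulSn iotaD map_cat add0n; congr (_ ++ _).
    rewrite -[RHS](mkseq_nth (1%g, set0)); apply/eq_in_map => i.
    by rewrite mem_iota /f => /andP[_ i_w]; rewrite modn_small.
  rewrite -{1}[size w]addn0 iotaDl -map_comp -IH; apply: eq_map => i.
  by rewrite /f /= modnDl.
pose x : R := 1 - 2%:R ^- size w.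
have pow_gt0 : 0 < 2%:R ^- size w :> R by rewrite invr_gt0 exprn_gt0 ?ltr0n.
have x_ge0 : 0 <= x by rewrite subr_ge0 invf_le1 ?exprn_ege1 ?exprn_gt0 ?ler1n ?ltr0n.
have x_lt1 : `|x| < 1 by rewrite ger0_norm // ltrBlDr ltrDl.
have wF' k : {subset flatten (nseq k w) <= FF}.
  by elim: k => //= k IH F; rewrite mem_cat => /orP[/wF|/IH].
have bad_le k d' : P d' -> bad_mass (flatten (nseq k w)) d' <= x ^+ k.
  elim: k d' => [|k IH] d' d'P /=; first by rewrite expr0; apply: (@bad_mass_le1 [::]).
  apply: (le_trans (bad_mass_cat wF (@wF' k) (exprn_ge0 k x_ge0) IH d'P)).
  rewrite exprSr ler_wpM2l ?exprn_ge0 //; exact/bad_mass_collapsing/w_coll.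
exists (fun n => full_tree (n * size w)), (fun _ s => f (size s)); split=> //.
- move=> n s t /prefixP[s' ->]; rewrite !mem_full_tree size_cat.
  exact/leq_ltn_trans/leq_addr.
- move=> n; apply/fsubsetP => s; rewrite !mem_full_tree mulSn => s_n.
  by apply: leq_trans s_n _; rewrite leq_addl.
- move=> n s; rewrite mem_full_tree => s_n; apply/wF/mem_nth; rewrite ltn_mod.
  by case: (size w) s_n => //; rewrite muln0.
have -> : (fun n => mu R (full_tree (n * size w)) (fun s => f (size s)) d CC) =
    (fun n => 1 - bad_mass (flatten (nseq n w)) d).
  by apply/funext => n; rewrite mu_full_tree f_period.
suff : ((1 - bad_mass (flatten (nseq n w)) d) @[n --> \oo] --> (1 - 0 : R))%classic.
  by rewrite subr0.
apply: cvgB; first exact: cvg_cst.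
apply: (@squeeze_cvgr _ _ _ _ (fun=> 0) (fun n => x ^+ n)).
- by apply: nearW => n; rewrite bad_mass_ge0 bad_le.
- exact: cvg_cst.
exact: cvg_expr.
Qed.

End Percolation.

(** * The cycle of implications *)

Theorem theorem8p2 (R : realType) (G : bigraph) (C C' : Type)
    (c : edge G -> C') (FF : {set prefold G}) (r : lvertex G -> C)
    (V1_neq0 : V1 G != set0)
    (G_connected : connected G)
    (FF_sub : FF \subset Fold_col c)
    (FF_invariant : invariant_folds (Aut_col c)%G FF)
    (r_rainbow : rainbow r) :
  [<->
    (* (1) *)
    left_cut_percolating FF;
    (* (2) *)
    forall l : lvertex G -> C, reach_set FF (tensor l c) (mono_tensors C c);
    (* (3) *)
    reach_set FF (tensor r c) (mono_tensors C c);
    (* (4) *)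
    forall l : lvertex G -> C,
      percolates_to R FF (tensor l c) (mono_tensors C c);
    (* (5) *)
    percolates_to R FF (tensor r c) (mono_tensors C c);
    (* (6) *)
    forall l : lvertex G -> C,
      fold_stable (Aut_col c)%G FF (tensor l c) -> monochromatic l;
    (* (7) *)
    forall l : lvertex G -> C,
      strongly_fold_stable (Fold G) (Aut_col c)%G FF (tensor l c) ->
      monochromatic l;
    (* (8) *)
    forall l : lvertex G -> C, maximal FF (tensor l c) -> monochromatic l;
    (* (9) *)
    left_vertex_transitive (fold_group FF) /\
    forall l : lvertex G -> C,
      left_symmetrically_fold_stable (Fold G) (Aut_col c)%G FF l c ->
      monochromatic l].
Proof.
have FF_Fold := invariant_folds_Fold FF_sub.
have FF_dual := invariant_folds_dual FF_sub FF_invariant.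
have reach_collapsing := rainbow_reach_collapsing G_connected FF_sub FF_invariant
  V1_neq0 r_rainbow.
have precomp_fold (l : lvertex G -> C) F : F \in FF ->
    precomp (tensor l c) (fold_map F) = tensor (l \o lmap (fold_map F)) c.
  move=> FFF; rewrite precomp_tensor ?(precomp_fold_col FF_sub FFF) //.
    exact/fold_map_endo/(subsetP FF_Fold).
  by move=> v; apply/fold_map_V1/(subsetP FF_Fold).
have [e e_min e_idem] := exists_idempotent_min_word FF_sub.
have [eF _] := e_min.
have e_reach : reach FF (tensor r c) (tensor (r \o lmap (word_map e)) c).
  by apply/(tensor_reachP FF_sub FF_invariant); exists e.
have e_collapsing : monochromatic (r \o lmap (word_map e)) -> exists s, collapsing FF s.
  move=> e_mono; apply: reach_collapsing.
  by exists (tensor (r \o lmap (word_map e)) c) => //; exists (r \o lmap (word_map e)).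
tfae.
- move/(left_cut_percolatingP FF_sub) => [s s_coll] l.
  exact: collapsing_reach s_coll.
- exact.
- move/reach_collapsing => [s s_coll] l; have [sF _] := s_coll.
  apply: (@collapsing_percolates R G _ FF (mono_tensors C c) FF_Fold FF_dual _
    (fun d => exists l, d = tensor l c) _ s); last by exists l.
  + move=> _ F FFF [m m_mono ->]; rewrite precomp_fold //.
    by exists (m \o lmap (fold_map F)) => // u v; apply: m_mono.
  + by move=> _ F FFF [m ->]; rewrite precomp_fold //; exists (m \o lmap (fold_map F)).
  + by [].
  move=> _ [m ->]; rewrite (foldl_precomp FF_Fold) // (precomp_tensor_word FF_sub) //.
  by exists (m \o lmap (word_map s)) => //; apply: (collapsing_mono FF_sub).
- exact.
- move/(percolates_reach FF_Fold FF_dual)/reach_collapsing => [s s_coll] l.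
  exact: (fold_stable_monochromatic G_connected FF_sub FF_invariant s_coll).
- by move=> stable_mono l [/stable_mono].
- move=> stable_mono l l_max.
  exact/stable_mono/(maximal_strongly_fold_stable FF_sub FF_invariant l_max).
- move=> max_mono; have [s s_coll] : exists s, collapsing FF s.
    exact/e_collapsing/max_mono/(min_word_maximal FF_sub FF_invariant e_min).
  split; first exact: (collapsing_transitive s_coll).
  move=> l [[l_stable _] _].
  exact: (fold_stable_monochromatic G_connected FF_sub FF_invariant s_coll l_stable).
move=> [trans sym_mono]; apply/(left_cut_percolatingP FF_sub)/e_collapsing/sym_mono.
apply: (min_word_left_symmetric FF_sub FF_invariant) => // u v uV vV.
(* Left symmetry asks for transitivity of [Aut_col c], which contains the generators of
   [fold_group FF]. *)
have [h hK hu] := trans u v uV vV; exists h => //; move: h hK {hu}.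
apply/subsetP; rewrite gen_subG; apply/subsetP => _ /imsetP[F FFF ->].
exact: (fold_Aut_col FF_sub).
Qed.
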